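(* Let $\Gamma$ be a ${\mathbb{Z}}$-tropical curve of genus $g \geq 2$, and let $D$ be a ${\mathbb{Z}}$-divisor on $\Gamma$ of degree $d \geq 2$. Assume that there exist an edge $e$ of the canonical model of $\Gamma$ and a positive integer $n$ such that $e$ is not a bridge and $nD$ is linearly equivalent to $\frac{nd}{2}[p] + \frac{nd}{2}[q]$, where $p$ and $q$ are the endpoints of $e$. Then the graded semi-ring $\bigoplus_{m=0}^\infty R(\Gamma, mD)$ is not finitely generated as a graded semi-ring over ${\mathbb{R}}^{\mathrm{trop}}$.
   Context: Finite graphs are connected and may have loops and multiple edges; a bridge is an edge whose removal disconnects the graph. A tropical curve $\Gamma$ is a metric space obtained from a finite graph $G$ and a length function $l: E(G) \to {\mathbb{R}}_{>0} \cup \{\infty\}$ by gluing intervals $[0,l(e)]$ according to the combinatorics of $G$, where only edges adjacent to one-valent vertices may have length $\infty$; it is assumed that $\Gamma$ is not homeomorphic to a circle. The valence $\mathrm{val}(x)$ of $x \in \Gamma$ is the number of connected components of $U_x \setminus \{x\}$ for a small neighborhood $U_x$. The canonical model $(G,l)$ of $\Gamma$ has as vertices exactly the points of valence $\neq 2$ and as edges the components of the complement. The genus $g$ is the first Betti number of $\Gamma$. $\Gamma$ is a ${\mathbb{Z}}$-tropical curve if every edge length in its canonical model is an integer or $\infty$; its ${\mathbb{Z}}$-points are the points at integer distance from the vertices of the canonical model. A divisor is a finite formal ${\mathbb{Z}}$-linear combination $D=\sum D(x)[x]$ of points; its degree is $\sum D(x)$; it is effective if all $D(x)\ge 0$; it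 is a ${\mathbb{Z}}$-divisor if its support consists of ${\mathbb{Z}}$-points. A rational function is a continuous function $f:\Gamma\to{\mathbb{R}}\cup\{\pm\infty\}$, piecewise linear with finitely many pieces and integer slopes, taking values $\pm\infty$ only at one-valent points; $\mathrm{ord}_x(f)$ is the sum of the outgoing slopes of $f$ at $x$, and $\mathrm{div}(f)=\sum_x \mathrm{ord}_x(f)[x]$. Divisors $D,D'$ are linearly equivalent if $D-D'=\mathrm{div}(f)$ for some rational $f$. $R(\Gamma,D)=\{f \text{ rational}: D+\mathrm{div}(f)\ge 0\}$. ${\mathbb{R}}^{\mathrm{trop}}=({\mathbb{R}},\max,+)$. The direct sum $\bigoplus_{m\ge0}R(\Gamma,mD)$ is a graded semi-ring over ${\mathbb{R}}^{\mathrm{trop}}$ with sum $(f\oplus g)(x)=\max\{f(x),g(x)\}$ within each degree, scalar action $(c\odot f)(x)=c+f(x)$, and product $(f\odot g)(x)=f(x)+g(x)$ sending degrees $n,k$ to degree $n+k$. It is finitely generated if there are finitely many homogeneous elements such that every homogeneous element is a finite tropical sum of ${\mathbb{R}}^{\mathrm{trop}}$-multiples of tropical products of these elements. *)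

(* Defs.v *)
From Stdlib Require Import Reals ZArith List.
From Coquelicot Require Import Rbar.
From mathcomp Require Import ssreflect ssrfun ssrbool eqtype ssrnat seq choice
  fintype fingraph bigop.

Set Implicit Arguments.
Unset Strict Implicit.
Unset Printing Implicit Defensive.

(* A Z-tropical curve, given through its canonical model (G, l).            *)
(* Edges are oriented src -> tgt only for parametrisation; an edge of       *)
(* length ∞ (len e = None) is parametrised by [0,∞] with src at 0 and the   *)
(* one-valent vertex tgt at ∞.                                              *)
Record tcurve := TCurve {
  V : finType;
  E : finType;
  src : E -> V;
  tgt : E -> V;
  len : E -> option nat   (* Some n = integer length n, None = ∞ *)
}.

Definition vdeg (C : tcurve) (v : V C) : nat :=
  #|[pred e : E C | src e == v]| + #|[pred e : E C | tgt e == v]|.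

Definition adj (C : tcurve) (ok : pred (E C)) : rel (V C) :=
  fun u v => [exists e : E C, ok e &&
     (((src e == u) && (tgt e == v)) || ((src e == v) && (tgt e == u)))].

Definition graph_connected (C : tcurve) : Prop :=
  forall u v : V C, connect (@adj C predT) u v.

Definition is_bridge (C : tcurve) (e0 : E C) : Prop :=
  ~ (forall u v : V C, connect (@adj C (predC1 e0)) u v).

(* (G,l) is the canonical model of a Z-tropical curve *)
Definition is_Ztrop_curve (C : tcurve) : Prop :=
  graph_connected C /\
  (forall v : V C, vdeg v <> 2%N) /\
  (forall e : E C, forall n, len e = Some n -> (0 < n)%N) /\
  (forall e : E C, len e = None -> vdeg (tgt e) = 1%N).

(* genus = first Betti number of the connected graph *)
Definition genus (C : tcurve) : Z :=
  (Z.of_nat #|E C| - Z.of_nat #|V C| + 1)%Z.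

Inductive pt (C : tcurve) : Type :=
  | PV : V C -> pt C
  | PE : E C -> R -> pt C.
Arguments PV {C}.
Arguments PE {C}.

Definition valid (C : tcurve) (x : pt C) : Prop :=
  match x with
  | PV _ => True
  | PE e t => (0 < t)%R /\
              match len e with Some n => (t < INR n)%R | None => True end
  end.

Definition fin_pt (C : tcurve) (x : pt C) : Prop :=
  valid x /\ forall e : E C, len e = None -> x <> PV (tgt e).

Definition Zpoint (C : tcurve) (x : pt C) : Prop :=
  match x with
  | PV _ => True
  | PE _ t => exists k : nat, t = INR k
  end.

Definition divisor (C : tcurve) := pt C -> Z.

Definition is_divisor (C : tcurve) (D : divisor C) : Prop :=
  (forall x, D x <> 0%Z -> valid x) /\
  exists l : list (pt C), forall x, D x <> 0%Z -> List.In x l.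

Definition is_Zdivisor (C : tcurve) (D : divisor C) : Prop :=
  is_divisor D /\ forall x, D x <> 0%Z -> Zpoint x.

Definition has_degree (C : tcurve) (D : divisor C) (d : Z) : Prop :=
  exists l : list (pt C), NoDup l /\ (forall x, D x <> 0%Z -> List.In x l) /\
    fold_right Z.add 0%Z (List.map D l) = d.

Definition scale_div (C : tcurve) (m : nat) (D : divisor C) : divisor C :=
  fun x => (Z.of_nat m * D x)%Z.

Definition two_pt_div (C : tcurve) (k : Z) (p q : V C) : divisor C :=
  fun x => match x with
           | PV v => ((if v == p then k else 0) + (if v == q then k else 0))%Z
           | PE _ _ => 0%Z
           end.

Definition fe (C : tcurve) (f : pt C -> Rbar) (e : E C) (t : R) : Rbar :=
  if Req_EM_T t 0 then f (PV (src e)) else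
  match len e with
  | Some n => if Req_EM_T t (INR n) then f (PV (tgt e)) else f (PE e t)
  | None => f (PE e t)
  end.

Definition pl_on (g : R -> R) (a b : R) : Prop :=
  exists (k : nat) (p : nat -> R) (s : nat -> Z),
    p 0%N = a /\ p k = b /\ (forall i, (i < k)%N -> (p i < p i.+1)%R) /\
    forall i t, (i < k)%N -> (p i <= t <= p i.+1)%R ->
      g t = (g (p i) + IZR (s i) * (t - p i))%R.

Definition is_rational (C : tcurve) (f : pt C -> Rbar) : Prop :=
  forall e : E C,
  match len e with
  | Some n => exists g : R -> R, pl_on g 0 (INR n) /\
      forall t, (0 <= t <= INR n)%R -> fe f e t = Rbar.Finite (g t)
  | None => exists (g : R -> R) (M : R) (s : Z),
      (0 < M)%R /\ pl_on g 0 M /\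
      (forall t, (M <= t)%R -> g t = (g M + IZR s * (t - M))%R) /\
      (forall t, (0 <= t)%R -> fe f e t = Rbar.Finite (g t)) /\
      f (PV (tgt e)) = (if (0 <? s)%Z then p_infty
                        else if (s <? 0)%Z then m_infty else Rbar.Finite (g M))
  end.

Definition rslope (C : tcurve) (f : pt C -> Rbar) (e : E C) (t : R) (s : Z) :=
  exists eps c, (0 < eps)%R /\ fe f e t = Rbar.Finite c /\
    forall h, (0 < h < eps)%R -> fe f e (t + h) = Rbar.Finite (c + IZR s * h).
Definition lslope (C : tcurve) (f : pt C -> Rbar) (e : E C) (t : R) (s : Z) :=
  exists eps c, (0 < eps)%R /\ fe f e t = Rbar.Finite c /\
    forall h, (0 < h < eps)%R -> fe f e (t - h) = Rbar.Finite (c - IZR s * h).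
Definition inf_slope (C : tcurve) (f : pt C -> Rbar) (e : E C) (s : Z) :=
  exists M c, (0 < M)%R /\
    forall t, (M <= t)%R -> f (PE e t) = Rbar.Finite (c + IZR s * (t - M)).

(* ord_x(f) = z : sum of outgoing slopes of f at x *)
Definition ord_rel (C : tcurve) (f : pt C -> Rbar) (x : pt C) (z : Z) : Prop :=
  match x with
  | PE e t => exists sr sl, rslope f e t sr /\ lslope f e t sl /\ z = (sr - sl)%Z
  | PV v => exists os ot : E C -> Z,
      (forall e, src e = v -> rslope f e 0 (os e)) /\
      (forall e, tgt e = v -> match len e with
                              | Some n => lslope f e (INR n) (ot e)
                              | None => inf_slope f e (ot e)
                              end) /\
      z = (\big[Z.add/0%Z]_(e | src e == v) os e
           - \big[Z.add/0%Z]_(e | tgt e == v) ot e)%Z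
  end.

Definition lin_equiv (C : tcurve) (D1 D2 : divisor C) : Prop :=
  exists f : pt C -> Rbar, is_rational f /\
    forall x, valid x -> forall z, ord_rel f x z -> (D1 x - D2 x)%Z = z.

Definition inR (C : tcurve) (D : divisor C) (f : pt C -> Rbar) : Prop :=
  is_rational f /\
    forall x, valid x -> forall z, ord_rel f x z -> (0 <= D x + z)%Z.

(* Finite generation of ⊕_m R(Γ, mD) as a graded semi-ring over R^trop.     *)
(* Generators: gen i ∈ R(Γ, (dg i) D), i < N.  Every homogeneous h of degree *)
(* m is max_{j<=J} (c j + Σ_i mono j i · gen i) with each monomial of degree *)
(* m.  Functions are compared on the points of Γ other than the points at   *)
(* infinity (where all values are real); by continuity this determines them.*)
Definition fin_generated (C : tcurve) (D : divisor C) : Prop :=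
  exists (N : nat) (dg : nat -> nat) (gen : nat -> pt C -> Rbar),
    (forall i, (i < N)%N -> inR (scale_div (dg i) D) (gen i)) /\
    forall (m : nat) (h : pt C -> Rbar), inR (scale_div m D) h ->
      exists (J : nat) (c : nat -> R) (mono : nat -> nat -> nat),
        (forall j, (j <= J)%N -> (\sum_(i < N) mono j i * dg i)%N = m) /\
        forall x, fin_pt x ->
          h x = Rbar.Finite (\big[Rmax/(c 0%N + \big[Rplus/0%R]_(i < N)
                                       (INR (mono 0%N i) * real (gen i x)))%R]_(j < J.+1)
                          (c j + \big[Rplus/0%R]_(i < N)
                                  (INR (mono j i) * real (gen i x)))%R).

(* Main.v *)
Require Import Defs.
From Stdlib Require Import Reals ZArith List Lra Lia Classical FunctionalExtensionality.
From Coquelicot Require Import Rbar.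
From HB Require Import structures.
From mathcomp Require Import ssreflect ssrfun ssrbool eqtype ssrnat seq choice
  fintype path fingraph bigop.

(* Let e = pq have length L. Multiplying by m, MD is equivalent to k[p] + k[q] for arbitrarily
   large k. In the graph without e move the chip at q towards p, across bridges separating q from
   p, to a vertex y where no further such bridge starts. Adding on e a function with slopes
   -k (or -k-1 if y = p) and k-1 gives H in R(MD) whose divisor MD + div H is (2k-1)[t0] + [y]
   (or 2k[t0] if y = p), with t0 in e tending strictly to the midpoint as k grows. Finitely many
   generators are affine on a left neighbourhood of the midpoint, so for large k every monomial is
   affine near t0. If H is a maximum of monomials, one of them, u, agrees with H right of t0; then
   u - H <= 0 vanishes at q. It is subharmonic except at t0 and for one chip at y, and a single chip
   at y cannot separate q from p without e, so u - H vanishes at p and hence on [p, t0]. Thus u has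
   the kink of H at t0, a contradiction. *)

Set Implicit Arguments.
Unset Strict Implicit.
Unset Printing Implicit Defensive.

Local Open Scope R_scope.

(** * Monoid structures for iterated sums, and induction along a real interval *)

HB.instance Definition _ := Monoid.isComLaw.Build R 0%R Rplus
  (fun x y z => esym (Rplus_assoc x y z)) Rplus_comm Rplus_0_l.
HB.instance Definition _ := Monoid.isComLaw.Build Z 0%Z Z.add
  Z.add_assoc Z.add_comm Z.add_0_l.

(** The supremum of the points up to which [P] holds throughout satisfies [P] by the last
    hypothesis, and the one before it rules out that this supremum lies below [b]. *)
Lemma real_induction (P : R -> Prop) (a b : R) :
  a <= b -> P a ->
  (forall t, a <= t < b -> P t ->
     exists2 eps, 0 < eps & forall t', t < t' < t + eps -> t' <= b -> P t') ->
  (forall t, a < t <= b -> (forall t', a <= t' < t -> P t') -> P t) ->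
  P b.
Proof.
move=> ab Pa Pr Pl.
pose Q t := a <= t <= b /\ forall t', a <= t' <= t -> P t'.
have Qa : Q a by split=> [|t' ?]; [lra | have -> : t' = a by lra].
have [] := completeness Q.
- by exists b => t [[]].
- by exists a.
move=> s [ub lub].
have as_ : a <= s by apply: ub.
have sb : s <= b by apply: lub => t [[]].
have below t' : a <= t' < s -> P t'.
  move=> t's; apply: NNPP => nP.
  have : s <= t'.
    apply: lub => t [tb Qt]; apply: Rnot_lt_le => t't; apply: nP; apply: Qt; lra.
  lra.
have Ps : P s.
  case: (Req_dec s a) => [-> //|sa]; apply: Pl => //; lra.
case: (Req_dec s b) => [<- //|sb'].
have [|eps eps0 He] := Pr s _ Ps; first lra.
pose t := Rmin (s + eps / 2) b.
have st : s < t by apply: Rmin_glb_lt; lra.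
have te : t <= s + eps / 2 by exact: Rmin_l.
have tb : t <= b by exact: Rmin_r.
suff : t <= s by lra.
apply: ub; split=> [|t' t't]; first lra.
case: (Rlt_le_dec t' s) => h; first by apply: below; lra.
case: (Req_dec t' s) => [-> //|?]; apply: He; lra.
Qed.

(** * One-sided integer slopes *)

(** Both one-sided slopes refer to increasing [t], so an outgoing slope to the left is the negative
    of [left_slope]. *)
Definition right_slope (g : R -> R) (t : R) (s : Z) :=
  exists2 eps, 0 < eps & forall h, 0 < h < eps -> g (t + h) = g t + IZR s * h.
Definition left_slope (g : R -> R) (t : R) (s : Z) :=
  exists2 eps, 0 < eps & forall h, 0 < h < eps -> g (t - h) = g t - IZR s * h.
Definition end_slope (g : R -> R) (s : Z) :=
  exists M, forall t, M <= t -> g t = g M + IZR s * (t - M).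

Lemma right_slope_lin (a b : Z) (g1 g2 : R -> R) (t : R) (s1 s2 : Z) :
  right_slope g1 t s1 -> right_slope g2 t s2 ->
  right_slope (fun t => IZR a * g1 t + IZR b * g2 t) t (a * s1 + b * s2).
Proof.
move=> [e1 e10 H1] [e2 e20 H2]; exists (Rmin e1 e2); first exact: Rmin_glb_lt.
move=> h [h0 he]; have ? := Rmin_l e1 e2; have ? := Rmin_r e1 e2.
rewrite H1 ?H2 ?plus_IZR ?mult_IZR; lra.
Qed.

Lemma left_slope_lin (a b : Z) (g1 g2 : R -> R) (t : R) (s1 s2 : Z) :
  left_slope g1 t s1 -> left_slope g2 t s2 ->
  left_slope (fun t => IZR a * g1 t + IZR b * g2 t) t (a * s1 + b * s2).
Proof.
move=> [e1 e10 H1] [e2 e20 H2]; exists (Rmin e1 e2); first exact: Rmin_glb_lt.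
move=> h [h0 he]; have ? := Rmin_l e1 e2; have ? := Rmin_r e1 e2.
rewrite H1 ?H2 ?plus_IZR ?mult_IZR; lra.
Qed.

Lemma end_slope_lin (a b : Z) (g1 g2 : R -> R) (s1 s2 : Z) :
  end_slope g1 s1 -> end_slope g2 s2 ->
  end_slope (fun t => IZR a * g1 t + IZR b * g2 t) (a * s1 + b * s2).
Proof.
move=> [M1 H1] [M2 H2]; exists (Rmax M1 M2) => t tM.
have ? := Rmax_l M1 M2; have ? := Rmax_r M1 M2.
rewrite (H1 t) ?(H1 (Rmax M1 M2)) ?(H2 t) ?(H2 (Rmax M1 M2)) ?plus_IZR ?mult_IZR; lra.
Qed.

Lemma right_slope_unique (g : R -> R) (t : R) (s1 s2 : Z) :
  right_slope g t s1 -> right_slope g t s2 -> s1 = s2.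
Proof.
move=> [e1 e10 H1] [e2 e20 H2]; apply: eq_IZR.
have ? : 0 < Rmin e1 e2 by exact: Rmin_glb_lt.
have ? := Rmin_l e1 e2; have ? := Rmin_r e1 e2.
have := H1 (Rmin e1 e2 / 2); rewrite H2; last lra.
move=> /(_ ltac:(lra)) ?.
apply: (Rmult_eq_reg_r (Rmin e1 e2 / 2)); lra.
Qed.

Lemma left_slope_unique (g : R -> R) (t : R) (s1 s2 : Z) :
  left_slope g t s1 -> left_slope g t s2 -> s1 = s2.
Proof.
move=> [e1 e10 H1] [e2 e20 H2]; apply: eq_IZR.
have ? : 0 < Rmin e1 e2 by exact: Rmin_glb_lt.
have ? := Rmin_l e1 e2; have ? := Rmin_r e1 e2.
have := H1 (Rmin e1 e2 / 2); rewrite H2; last lra.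
move=> /(_ ltac:(lra)) ?.
apply: (Rmult_eq_reg_r (Rmin e1 e2 / 2)); lra.
Qed.

Lemma end_slope_unique (g : R -> R) (s1 s2 : Z) :
  end_slope g s1 -> end_slope g s2 -> s1 = s2.
Proof.
move=> [M1 H1] [M2 H2]; apply: eq_IZR.
have ? := Rmax_l M1 M2; have ? := Rmax_r M1 M2.
have := H1 (Rmax M1 M2 + 1); have := H1 (Rmax M1 M2).
have := H2 (Rmax M1 M2 + 1); have := H2 (Rmax M1 M2).
do 4 (move=> /(_ ltac:(lra)) ?); lra.
Qed.

Lemma right_slope_opp (g : R -> R) (t : R) (s : Z) :
  left_slope g (- t) s -> right_slope (fun t => g (- t)) t (- s).
Proof.
move=> [eps e0 H]; exists eps => // h he.
have -> : - (t + h) = - t - h by lra.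
rewrite H // opp_IZR; lra.
Qed.

Lemma left_slope_opp (g : R -> R) (t : R) (s : Z) :
  right_slope g (- t) s -> left_slope (fun t => g (- t)) t (- s).
Proof.
move=> [eps e0 H]; exists eps => // h he.
have -> : - (t - h) = - t + h by lra.
rewrite H // opp_IZR; lra.
Qed.

Lemma right_slope_le0 (g : R -> R) (a b : R) (s : Z) :
  a < b -> (forall t, a < t < b -> g t <= 0) -> g a = 0 -> right_slope g a s -> (s <= 0)%Z.
Proof.
move=> ab g0 ga [eps e0 H]; apply: le_IZR.
have m0 : 0 < Rmin eps (b - a) by apply: Rmin_glb_lt; lra.
have ? := Rmin_l eps (b - a); have ? := Rmin_r eps (b - a).
have := g0 (a + Rmin eps (b - a) / 2); rewrite H ?ga; last lra.
move=> /(_ ltac:(lra)) h.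
apply: (Rmult_le_reg_r (Rmin eps (b - a) / 2)); lra.
Qed.

Lemma left_slope_ge0 (g : R -> R) (a b : R) (s : Z) :
  a < b -> (forall t, a < t < b -> g t <= 0) -> g b = 0 -> left_slope g b s -> (0 <= s)%Z.
Proof.
move=> ab g0 gb sl.
have : (- s <= 0)%Z; last lia.
apply: (@right_slope_le0 (fun t => g (- t)) (- b) (- a)); rewrite ?Ropp_involutive //; first lra.
- by move=> t ?; apply: g0; lra.
- by apply: right_slope_opp; rewrite Ropp_involutive.
Qed.

(** Maximum principle on an interval: where [g] vanishes up to some [t > a], its left slope at [t]
    is 0, so the right slope is nonnegative by convexity and nonpositive by maximality. Hence the
    zero set advances, and left slopes make it closed. *)
Lemma convex_zero (g : R -> R) (a b : R) :
  a < b -> (forall t, a <= t <= b -> g t <= 0) -> g a = 0 -> right_slope g a 0 ->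
  (forall t, a < t < b -> exists sr sl,
     right_slope g t sr /\ left_slope g t sl /\ (sl <= sr)%Z) ->
  (exists s, left_slope g b s) ->
  forall t, a <= t <= b -> g t = 0.
Proof.
move=> ab g0 ga ra int lb.
have lsl t : a < t <= b -> exists s, left_slope g t s.
  move=> tb; case: (Req_dec t b) => [-> //|tb'].
  by have [|sr [sl [_ [? _]]]] := int t; [lra|exists sl].
apply: (@real_induction (fun x => forall t, a <= t <= x -> g t = 0) a b); first lra.
- by move=> t ?; have -> : t = a by lra.
- move=> t tb zt.
  have [eps e0 H] : right_slope g t 0.
    case: (Req_dec t a) => [-> //|ta].
    have [|sr [sl [r [l le]]]] := int t; first lra.
    have sl0 : sl = 0%Z.
      apply: left_slope_unique l _; exists (t - a); first lra.
      by move=> h ?; rewrite !zt; lra.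
    have sr0 : (sr <= 0)%Z.
      apply: (right_slope_le0 _ _ _ r); first exact: (proj2 tb).
        by move=> ? ?; apply: g0; lra.
      by apply: zt; lra.
    by have <- : sr = 0%Z by lia.
  exists eps => // t' t't t'b t'' ht''.
  case: (Rle_dec t'' t) => h; first by apply: zt; lra.
  have -> : t'' = t + (t'' - t) by lra.
  rewrite H ?zt; lra.
- move=> t tb zt t' t't.
  have z x : a <= x < t -> g x = 0 by move=> ?; apply: (zt x); lra.
  case: (Req_dec t' t) => [->|?]; last by apply: z; lra.
  have [s [eps e0 H]] := lsl t tb.
  have ? : 0 < Rmin eps (t - a) by apply: Rmin_glb_lt; lra.
  have ? := Rmin_l eps (t - a); have ? := Rmin_r eps (t - a).
  (* Two zeros of the affine piece to the left of [t] force its value at [t] to vanish. *)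
  have := H (Rmin eps (t - a) / 2) ltac:(lra); rewrite (z (t - _)); last lra.
  have := H (Rmin eps (t - a) / 4) ltac:(lra); rewrite (z (t - _)); last lra.
  lra.
Qed.

Lemma convex_zero_left (g : R -> R) (a b : R) :
  a < b -> (forall t, a <= t <= b -> g t <= 0) -> g b = 0 -> left_slope g b 0 ->
  (forall t, a < t < b -> exists sr sl,
     right_slope g t sr /\ left_slope g t sl /\ (sl <= sr)%Z) ->
  (exists s, right_slope g a s) ->
  forall t, a <= t <= b -> g t = 0.
Proof.
move=> ab g0 gb lb int [s ra] t tb.
rewrite -(Ropp_involutive t).
apply: (@convex_zero (fun t => g (- t)) (- b) (- a)); rewrite ?Ropp_involutive //; try lra.
- by move=> t' ?; apply: g0; lra.
- by apply: (@right_slope_opp _ _ 0); rewrite Ropp_involutive.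
- move=> t' t'b; have [|sr [sl [r [l le]]]] := int (- t'); first lra.
  exists (- sl)%Z, (- sr)%Z; split; first exact: right_slope_opp.
  split; [exact: left_slope_opp|lia].
- by exists (- s)%Z; apply: left_slope_opp; rewrite Ropp_involutive.
Qed.

(** * Piecewise linearity and one-sided slopes *)

Lemma locate_piece (p : nat -> R) (k : nat) (t : R) :
  p 0%N <= t < p k -> exists2 i, (i < k)%N & p i <= t < p i.+1.
Proof.
elim: k => [|k IH] h; first lra.
case: (Rlt_le_dec t (p k)) => tk; last by exists k => //; lra.
by have [|i ik ?] := IH; [lra|exists i => //; apply: ltnW].
Qed.

Lemma locate_piece_left (p : nat -> R) (k : nat) (t : R) :
  p 0%N < t <= p k -> exists2 i, (i < k)%N & p i < t <= p i.+1.
Proof.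
elim: k => [|k IH] h; first lra.
case: (Rle_lt_dec t (p k)) => tk; last by exists k => //; lra.
by have [|i ik ?] := IH; [lra|exists i => //; apply: ltnW].
Qed.

Lemma pl_on_right_slope (g : R -> R) (a b t : R) :
  pl_on g a b -> a <= t < b -> exists s, right_slope g t s.
Proof.
move=> [k [p [s [p0 [pk [_ lin]]]]]] tb.
have [|i ik ti] := @locate_piece p k t; first by rewrite p0 pk.
exists (s i), (p i.+1 - t); first lra.
move=> h he; rewrite (lin i (t + h)) // ?(lin i t) //; lra.
Qed.

Lemma pl_on_left_slope (g : R -> R) (a b t : R) :
  pl_on g a b -> a < t <= b -> exists s, left_slope g t s.
Proof.
move=> [k [p [s [p0 [pk [_ lin]]]]]] tb.
have [|i ik ti] := @locate_piece_left p k t; first by rewrite p0 pk.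
exists (s i), (t - p i); first lra.
move=> h he; rewrite (lin i (t - h)) // ?(lin i t) //; lra.
Qed.

Lemma pl_on_extend (g : R -> R) (a b c : R) (s : Z) :
  pl_on g a b -> b < c -> (forall t, b <= t <= c -> g t = g b + IZR s * (t - b)) ->
  pl_on g a c.
Proof.
move=> [k [p [sl [p0 [pk [inc lin]]]]]] bc H.
exists k.+1, (fun i => if (i <= k)%N then p i else c), (fun i => if (i < k)%N then sl i else s).
rewrite /= ltnn; do 3 split=> //.
  move=> i; rewrite ltnS => le_ik.
  have /orP[/eqP ->|ik] : (i == k) || (i < k)%N by rewrite -leq_eqVlt.
    by rewrite leqnn ltnn pk.
  by rewrite le_ik ik; apply: inc.
move=> i t; rewrite ltnS => le_ik.
have /orP[/eqP ->|ik] : (i == k) || (i < k)%N by rewrite -leq_eqVlt.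
  by rewrite leqnn ltnn pk; apply: H.
by rewrite le_ik ik; apply: lin.
Qed.

(** Compactness through real induction: affine germs on both sides of every point combine into
    finitely many pieces. *)
Lemma slopes_pl_on (g : R -> R) (a b : R) :
  a <= b -> (forall t, a <= t < b -> exists s, right_slope g t s) ->
  (forall t, a < t <= b -> exists s, left_slope g t s) -> pl_on g a b.
Proof.
move=> ab Hr Hl; apply: (@real_induction (pl_on g a) a b) => //.
- by exists 0%N, (fun=> a), (fun=> 0%Z); do 3 split=> //.
- move=> t tb plt; have [s [eps e0 H]] := Hr t tb.
  exists eps => // t' t't t'b; apply: (pl_on_extend (s := s) plt); first lra.
  move=> x xt; case: (Req_dec x t) => [->|?]; first lra.
  rewrite -H; last lra.
  by congr g; lra.
- move=> t tb plt; have [s [eps e0 H]] := Hl t tb.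
  have ? : 0 < Rmin eps (t - a) by apply: Rmin_glb_lt; lra.
  have ? := Rmin_l eps (t - a); have ? := Rmin_r eps (t - a).
  set d := Rmin eps (t - a) / 2.
  have ? : 0 < d < eps by rewrite /d; lra.
  have ? : d < t - a by rewrite /d; lra.
  have aff x : t - d <= x <= t -> g x = g t - IZR s * (t - x).
    move=> xt; case: (Req_dec x t) => [->|?]; first lra.
    by rewrite -H; [congr g; lra|lra].
  apply: (pl_on_extend (b := t - d) (s := s)); [apply: plt; lra|lra|].
  move=> x xt; rewrite (aff x) ?(aff (t - d)); lra.
Qed.

Lemma right_slope_congr (g1 g2 : R -> R) (t b : R) (s : Z) :
  t < b -> (forall x, t <= x < b -> g1 x = g2 x) -> right_slope g1 t s -> right_slope g2 t s.
Proof.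
move=> tb g12 [eps e0 H]; exists (Rmin eps (b - t)); first by apply: Rmin_glb_lt; lra.
move=> h hm; have ? := Rmin_l eps (b - t); have ? := Rmin_r eps (b - t).
by rewrite -!g12 ?H; lra.
Qed.

Lemma left_slope_congr (g1 g2 : R -> R) (a t : R) (s : Z) :
  a < t -> (forall x, a < x <= t -> g1 x = g2 x) -> left_slope g1 t s -> left_slope g2 t s.
Proof.
move=> at_ g12 [eps e0 H]; exists (Rmin eps (t - a)); first by apply: Rmin_glb_lt; lra.
move=> h hm; have ? := Rmin_l eps (t - a); have ? := Rmin_r eps (t - a).
by rewrite -!g12 ?H; lra.
Qed.

(** * Orders of edgewise functions *)

(* A half-edge is [inl e] at the source of [e] or [inr e] at its target. *)
Definition half_end (C : tcurve) (h : E C + E C) : V C :=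
  match h with inl e => src e | inr e => tgt e end.
Definition half_edge (C : tcurve) (h : E C + E C) : E C :=
  match h with inl e => e | inr e => e end.
Definition half_opp (C : tcurve) (h : E C + E C) : E C + E C :=
  match h with inl e => inr e | inr e => inl e end.

(** At a target the parameter increases towards the vertex, hence the sign; at a point at infinity
    the slope is the eventual one. *)
Definition out_slope (C : tcurve) (u : E C -> R -> R) (h : E C + E C) (s : Z) :=
  match h with
  | inl e => right_slope (u e) 0 s
  | inr e => match len e with
             | Some n => left_slope (u e) (INR n) (- s)
             | None => end_slope (u e) (- s)
             end
  end.

(** Order of a real function of edge parameters. Values at infinity never enter, so differences of
    functions make sense. *)
Definition edge_ord (C : tcurve) (u : E C -> R -> R) (x : pt C) (z : Z) :=
  match x with
  | PE e t => exists sr sl,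
      right_slope (u e) t sr /\ left_slope (u e) t sl /\ z = (sr - sl)%Z
  | PV v => exists2 o : E C + E C -> Z,
      (forall h, half_end h = v -> out_slope u h (o h))
      & z = \big[Z.add/0%Z]_(h | half_end h == v) o h
  end.

Lemma out_slope_lin (C : tcurve) (a b : Z) (u1 u2 : E C -> R -> R) (h : E C + E C) (s1 s2 : Z) :
  out_slope u1 h s1 -> out_slope u2 h s2 ->
  out_slope (fun e t => IZR a * u1 e t + IZR b * u2 e t) h (a * s1 + b * s2).
Proof.
case: h => e /=; first exact: right_slope_lin.
have -> : (- (a * s1 + b * s2) = a * - s1 + b * - s2)%Z by lia.
by case: (len e) => [n|]; [exact: left_slope_lin|exact: end_slope_lin].
Qed.

Lemma out_slope_unique (C : tcurve) (u : E C -> R -> R) (h : E C + E C) (s1 s2 : Z) :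
  out_slope u h s1 -> out_slope u h s2 -> s1 = s2.
Proof.
case: h => e /=; first exact: right_slope_unique.
case: (len e) => [n|] H1 H2.
  by have := left_slope_unique H1 H2; lia.
by have := end_slope_unique H1 H2; lia.
Qed.

Lemma edge_ord_lin (C : tcurve) (a b : Z) (u1 u2 : E C -> R -> R) (x : pt C) (z1 z2 : Z) :
  edge_ord u1 x z1 -> edge_ord u2 x z2 ->
  edge_ord (fun e t => IZR a * u1 e t + IZR b * u2 e t) x (a * z1 + b * z2).
Proof.
case: x => [v|e t] /=.
  move=> [o1 H1 ->] [o2 H2 ->]; exists (fun h => a * o1 h + b * o2 h)%Z.
    by move=> h hv; apply: out_slope_lin; [exact: H1|exact: H2].
  elim/big_rec3: _ => [|h s3 s2 s1 _ <-]; lia.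
move=> [r1 [l1 [R1 [L1 ->]]]] [r2 [l2 [R2 [L2 ->]]]].
exists (a * r1 + b * r2)%Z, (a * l1 + b * l2)%Z; split; first exact: right_slope_lin.
split; [exact: left_slope_lin|lia].
Qed.

Lemma edge_ord_const (C : tcurve) (c : R) (x : pt C) : edge_ord (fun _ _ => c) x 0.
Proof.
have rc t : right_slope (fun=> c) t 0 by exists 1; [|move=> *]; lra.
have lc t : left_slope (fun=> c) t 0 by exists 1; [|move=> *]; lra.
case: x => [v|e t] /=; last by exists 0%Z, 0%Z.
exists (fun=> 0%Z); last by rewrite big1_eq.
move=> [e|e] _ //=; case: (len e) => // .
by exists 0 => *; lra.
Qed.

Lemma edge_ord_ext (C : tcurve) (u1 u2 : E C -> R -> R) (x : pt C) (z : Z) :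
  (forall e t, u1 e t = u2 e t) -> edge_ord u1 x z -> edge_ord u2 x z.
Proof.
by move=> u12; have -> : u1 = u2 by do 2 (apply: functional_extensionality => ?).
Qed.

Lemma edge_ord_unique (C : tcurve) (u : E C -> R -> R) (x : pt C) (z1 z2 : Z) :
  edge_ord u x z1 -> edge_ord u x z2 -> z1 = z2.
Proof.
case: x => [v|e t] /=.
  move=> [o1 H1 ->] [o2 H2 ->]; apply: eq_bigr => h /eqP hv.
  by apply: out_slope_unique (H1 h hv) (H2 h hv).
move=> [r1 [l1 [R1 [L1 ->]]]] [r2 [l2 [R2 [L2 ->]]]].
by rewrite (right_slope_unique R1 R2) (left_slope_unique L1 L2).
Qed.

(** * Rational functions as functions of edge parameters *)

Definition edge_fun (C : tcurve) (f : pt C -> Rbar) (e : E C) (t : R) : R := real (Defs.fe f e t).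

Definition edge_dom (C : tcurve) (e : E C) (t : R) : Prop :=
  0 <= t /\ match len e with Some n => t <= INR n | None => True end.

Lemma rational_finite (C : tcurve) (f : pt C -> Rbar) (e : E C) (t : R) :
  is_rational f -> edge_dom e t -> Defs.fe f e t = Rbar.Finite (edge_fun f e t).
Proof.
move=> /(_ e); rewrite /edge_dom /edge_fun; case: (len e) => [n|].
  by move=> [g [_ H]] t0; rewrite H.
by move=> [g [M [s [_ [_ [_ [H _]]]]]]] [t0 _]; rewrite H.
Qed.

Lemma rational_right_slope (C : tcurve) (f : pt C -> Rbar) (e : E C) (t : R) :
  is_rational f -> 0 <= t -> match len e with Some n => t < INR n | None => True end ->
  exists s, right_slope (edge_fun f e) t s.
Proof.
move=> /(_ e); rewrite /edge_fun; case: (len e) => [n|].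
  move=> [g [gpl H]] t0 tn.
  have [|s sg] := pl_on_right_slope (t := t) gpl; first lra.
  exists s; apply: right_slope_congr tn _ sg => x xt; rewrite H //; lra.
move=> [g [M [s [M0 [gpl [gM [H _]]]]]]] t0 _.
case: (Rlt_le_dec t M) => tM.
  have [|s' sg] := pl_on_right_slope (t := t) gpl; first lra.
  exists s'; apply: right_slope_congr tM _ sg => x xt; rewrite H //; lra.
exists s, 1; first lra.
move=> h ?; rewrite !H; try lra.
rewrite /= !(gM (_ + _)) ?(gM t); lra.
Qed.

Lemma rational_left_slope (C : tcurve) (f : pt C -> Rbar) (e : E C) (t : R) :
  is_rational f -> 0 < t -> match len e with Some n => t <= INR n | None => True end ->
  exists s, left_slope (edge_fun f e) t s.
Proof.
move=> /(_ e); rewrite /edge_fun; case: (len e) => [n|].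
  move=> [g [gpl H]] t0 tn.
  have [|s sg] := pl_on_left_slope (t := t) gpl; first lra.
  exists s; apply: left_slope_congr t0 _ sg => x xt; rewrite H //; lra.
move=> [g [M [s [M0 [gpl [gM [H _]]]]]]] t0 _.
case: (Rle_lt_dec t M) => tM.
  have [|s' sg] := pl_on_left_slope (t := t) gpl; first lra.
  exists s'; apply: left_slope_congr t0 _ sg => x xt; rewrite H //; lra.
exists s, (t - M); first lra.
move=> h ?; rewrite !H; try lra.
rewrite /= !(gM (_ - _)) ?(gM t); lra.
Qed.

Lemma rational_end_slope (C : tcurve) (f : pt C -> Rbar) (e : E C) :
  is_rational f -> len e = None -> exists s, end_slope (edge_fun f e) s.
Proof.
move=> /(_ e); rewrite /edge_fun => + le; rewrite le.
move=> [g [M [s [M0 [gpl [gM [H _]]]]]]].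
exists s, M => t tM; rewrite !H; try lra.
by rewrite /= gM.
Qed.

(** [inR] and [lin_equiv] constrain every order that exists; existence at each valid point turns
    them into genuine bounds. *)
Lemma rational_ord (C : tcurve) (f : pt C -> Rbar) (x : pt C) :
  (forall (e : E C) n, len e = Some n -> 0 < INR n) ->
  is_rational f -> valid x -> exists z, edge_ord (edge_fun f) x z.
Proof.
move=> pos rf; case: x => [v|e t] /=.
  move=> _.
  have /fin_all_exists [o Ho] (h : E C + E C) : exists s, out_slope (edge_fun f) h s.
    case: h => e /=.
      apply: rational_right_slope => //; first lra.
      by case le: (len e) => [n|] //; apply: (pos e).
    case le: (len e) => [n|].
      have [||s ?] := @rational_left_slope C f e (INR n) rf; first exact: (pos e).
        by rewrite le; lra.
      by exists (- s)%Z; rewrite Z.opp_involutive.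
    have [s ?] := rational_end_slope rf le.
    by exists (- s)%Z; rewrite Z.opp_involutive.
  by exists (\big[Z.add/0%Z]_(h | half_end h == v) o h), o.
move=> [t0 tn].
have [||sr Hr] := @rational_right_slope C f e t rf => //; first lra.
have [||sl Hl] := @rational_left_slope C f e t rf => //.
  by case: (len e) tn => // n; lra.
by exists (sr - sl)%Z, sr, sl.
Qed.

Lemma ord_rel_edge_ord (C : tcurve) (f : pt C -> Rbar) (x : pt C) (z : Z) :
  ord_rel f x z -> edge_ord (edge_fun f) x z.
Proof.
have rsl e t s : rslope f e t s -> right_slope (edge_fun f e) t s.
  by move=> [eps [c [e0 [fc H]]]]; exists eps => // h hh; rewrite /edge_fun H // fc.
have lsl e t s : lslope f e t s -> left_slope (edge_fun f e) t s.
  by move=> [eps [c [e0 [fc H]]]]; exists eps => // h hh; rewrite /edge_fun H // fc.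
case: x => [v|e t] /=; last first.
  by move=> [sr [sl [/rsl Hr [/lsl Hl ->]]]]; exists sr, sl.
move=> [os [ot [Hs [Ht ->]]]].
exists (fun h => match h with inl e => os e | inr e => - ot e end)%Z.
  move=> [e|e] /= ev; first by apply: rsl; apply: Hs.
  move: (Ht e ev); rewrite Z.opp_involutive; case le: (len e) => [n|]; first exact: lsl.
  move=> [M [c [M0 H]]]; exists M => t tM.
  have fM x : M <= x -> edge_fun f e x = c + IZR (ot e) * (x - M).
    move=> xM; rewrite /edge_fun /Defs.fe le; case: Req_EM_T => [?|? /=]; first lra.
    by rewrite H.
  rewrite (fM t) ?(fM M); lra.
rewrite big_sumType /=; congr Z.add.
by elim/big_rec2: _ => [|e a b Pe IH]; lia.
Qed.

Lemma edge_ord_ord_rel (C : tcurve) (f : pt C -> Rbar) (x : pt C) (z : Z) :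
  (forall (e : E C) n, len e = Some n -> 0 < INR n) ->
  is_rational f -> valid x -> edge_ord (edge_fun f) x z -> ord_rel f x z.
Proof.
move=> pos rf.
have rsl e t s : 0 <= t -> match len e with Some n => t < INR n | None => True end ->
    right_slope (edge_fun f e) t s -> rslope f e t s.
  move=> t0 tn [eps e0 H].
  (* The germ is shortened so that [t + h] stays on the edge, where [f] is finite. *)
  have [eps' [e'0 [e'e dom]]] : exists eps', 0 < eps' /\ eps' <= eps /\
      forall h, 0 <= h < eps' -> edge_dom e (t + h).
    rewrite /edge_dom; case: (len e) tn => [n|] tn; last first.
      by exists eps; split => //; split; [lra|move=> *; split; [lra|]].
    exists (Rmin eps (INR n - t)); split; first by apply: Rmin_glb_lt; lra.
    split; first exact: Rmin_l.
    by move=> h ?; have ? := Rmin_r eps (INR n - t); lra.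
  exists eps', (edge_fun f e t); split => //; split.
    by rewrite -rational_finite // -(Rplus_0_r t); apply: dom; lra.
  move=> h hh; rewrite -H; last lra.
  by apply: rational_finite => //; apply: dom; lra.
have lsl e t s : 0 < t -> match len e with Some n => t <= INR n | None => True end ->
    left_slope (edge_fun f e) t s -> lslope f e t s.
  move=> t0 tn [eps e0 H].
  have dom h : 0 <= h <= t -> edge_dom e (t - h).
    rewrite /edge_dom; case: (len e) tn => [n|] tn hh; split => //; lra.
  exists (Rmin eps t), (edge_fun f e t); split; first exact: Rmin_glb_lt.
  split.
    by rewrite -rational_finite // -(Rminus_0_r t); apply: dom; lra.
  move=> h hh; have ? := Rmin_l eps t; have ? := Rmin_r eps t.
  rewrite -H; last lra.
  by apply: rational_finite => //; apply: dom; lra.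
case: x => [v|e t] /=; last first.
  move=> [t0 tn] [sr [sl [Hr [Hl ->]]]]; exists sr, sl; split; first by apply: rsl => //; lra.
  by split=> //; apply: lsl => //; case: (len e) tn => // n; lra.
move=> _ [o Ho ->]; exists (fun e => o (inl e)), (fun e => - o (inr e))%Z; split.
  move=> e ev; apply: rsl (Ho (inl e) ev); first lra.
  by case le: (len e) => [n|] //; apply: (pos e).
split.
  move=> e ev; have := Ho (inr e) ev; rewrite /=; case le: (len e) => [n|].
    by apply: lsl; [apply: (pos e)|rewrite le; lra].
  move=> [M HM]; exists (Rmax M 1), (edge_fun f e (Rmax M 1)).
  have ? := Rmax_l M 1; have ? := Rmax_r M 1; split; first lra.
  move=> t tM.
  have <- : Defs.fe f e t = f (PE e t).
    by rewrite /Defs.fe le; case: Req_EM_T => // ?; lra.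
  rewrite rational_finite // /edge_dom ?le; last by split; [lra|].
  rewrite (HM t) ?(HM (Rmax M 1)); try lra.
  by congr Rbar.Finite; lra.
rewrite big_sumType /=; congr Z.add.
by elim/big_rec2: _ => [|e a b Pe IH]; lia.
Qed.

(** * Moving a chip across bridges *)

Lemma half_opp_edge (C : tcurve) (h : E C + E C) : half_edge (half_opp h) = half_edge h.
Proof. by case: h. Qed.

Lemma half_cases (C : tcurve) (h1 h2 : E C + E C) :
  half_edge h1 = half_edge h2 -> h1 = h2 \/ h1 = half_opp h2.
Proof. by case: h1 => a; case: h2 => b /= ->; [left|right|right|left]. Qed.

(** A second half-edge at the tip would raise [vdeg] above 1. *)
Lemma tip_half (C : tcurve) (e : E C) (h : E C + E C) :
  vdeg (tgt e) = 1%N -> half_end h = tgt e -> h = inr e.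
Proof.
rewrite /vdeg (cardD1 e [pred e0 | tgt e0 == tgt e]) inE eqxx.
case: h => e' /= V1 He'; move: V1.
  by rewrite (cardD1 e') inE He' eqxx add1n addSn addnS.
case: (eqVneq e' e) => [-> //|ne].
by rewrite [X in (_ + (_ + X))%N](cardD1 e') !inE ne He' eqxx !addnS.
Qed.

Lemma finite_end_not_tip (C : tcurve) (h : E C + E C) (e : E C) :
  (forall e : E C, len e = None -> vdeg (tgt e) = 1%N) ->
  len (half_edge h) <> None -> len e = None -> half_end h <> tgt e.
Proof. by move=> tip fin inf /(tip_half (tip e inf)) hE; move: fin; rewrite hE. Qed.

Lemma adjP (C : tcurve) (ok : pred (E C)) (u v : V C) :
  reflect (exists2 h, ok (half_edge h) & half_end h = u /\ half_end (half_opp h) = v)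
          (adj ok u v).
Proof.
apply: (iffP existsP) => [[e /andP[oke /orP[]/andP[/eqP <- /eqP <-]]]|[[e|e] /= oke [<- <-]]].
- by exists (inl e).
- by exists (inr e).
- by exists e; rewrite oke !eqxx.
- by exists e; rewrite oke !eqxx orbT.
Qed.

Lemma connect_closed (C : tcurve) (ok : pred (E C)) (S : V C -> Prop) (u v : V C) :
  (forall h, ok (half_edge h) -> S (half_end h) -> S (half_end (half_opp h))) ->
  connect (adj ok) u v -> S u -> S v.
Proof.
move=> clS /connectP[l + ->]; elim: l u => [//|w l IH] u /= /andP[/adjP[h okh [<- <-]] pl] Su.
by apply: IH pl _; apply: clS.
Qed.

Lemma connect_edge (C : tcurve) (ok : pred (E C)) (u : V C) (h : E C + E C) :
  ok (half_edge h) -> connect (adj ok) u (half_end h) ->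
  connect (adj ok) u (half_end (half_opp h)).
Proof.
by move=> okh uh; apply: connect_trans uh (connect1 _); apply/adjP; exists h.
Qed.

(** A path from [S] to its complement has a step leaving [S]; by hypothesis this step ends in [u],
    and the tail from there is shorter. *)
Lemma path_leaving (C : tcurve) (ok : pred (E C)) (S : pred (V C)) (u y : V C) (l : seq (V C)) :
  (forall a b, adj ok a b -> S a -> ~~ S b -> b = u) ->
  path (adj ok) y l -> S y -> ~~ S (last y l) ->
  exists l', [/\ path (adj ok) u l', last u l' = last y l & (size l' < size l)%N].
Proof.
move=> out; elim: l y => [|w l IH] y /=; first by move=> _ ->.
move=> /andP[yw pl] Sy Sl; case: (boolP (S w)) => Sw.
  by have [l' [? ? ?]] := IH w pl Sw Sl; exists l'; split=> //; apply: ltnW.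
by have wu := out _ _ yw Sy Sw; exists l; rewrite -wu.
Qed.

Definition half_sign (C : tcurve) (s : E C -> Z) (h : E C + E C) : Z :=
  match h with inl e => s e | inr e => (- s e)%Z end.

Definition indic (b : bool) : Z := (if b then 1 else 0)%Z.

Lemma sum_half_delta (C : tcurve) (h : E C + E C) (c : Z) (v : V C) :
  \big[Z.add/0%Z]_(h' | half_end h' == v) (if h' == h then c else 0%Z)
  = (c * indic (v == half_end h))%Z.
Proof.
rewrite -big_mkcondr /= /indic (eq_sym v).
case: ifP => [/eqP hv|hv].
  rewrite (big_pred1 h) ?Z.mul_1_r // => h' /=.
  by case: (eqVneq h' h) => [->|]; rewrite ?andbF //= ?hv ?eqxx.
rewrite big_pred0 ?Z.mul_0_r // => h' /=.
by case: (eqVneq h' h) => [->|]; rewrite ?andbF // hv.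
Qed.

Definition avoid2 (C : tcurve) (e1 e2 : E C) : pred (E C) :=
  fun e => (e != e1) && (e != e2).

(* [g] (vertex values) and [s] (slopes) describe a function on [C] minus [e] with divisor
   [y] - [tgt e]. *)
Definition moves_chip (C : tcurve) (e : E C) (y : V C) (g : V C -> Z) (s : E C -> Z) : Prop :=
  [/\ forall e', e' != e -> match len e' with
        | Some n => g (tgt e') = (g (src e') + s e' * Z.of_nat n)%Z
        | None => g (tgt e') = g (src e') /\ s e' = 0%Z
        end,
      s e = 0%Z,
      forall v, \big[Z.add/0%Z]_(h | half_end h == v) half_sign s h
                = (indic (v == y) - indic (v == tgt e))%Z
    & (g (src e) <= g (tgt e))%Z].

(* The second alternative covers the bridge through which the chip arrived at [y]. *)
Definition unfireable (C : tcurve) (e : E C) (y : V C) : Prop :=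
  forall h, half_end h = y -> half_edge h != e -> len (half_edge h) <> None ->
    connect (adj (avoid2 e (half_edge h))) (tgt e) (src e) \/
    connect (adj (avoid2 e (half_edge h))) (tgt e) (half_end (half_opp h)).

(* Firing the whole side [S] of the bridge [half_edge h] moves the chip to its other end. *)
Lemma moves_chip_step (C : tcurve) (e : E C) (y : V C) (g : V C -> Z) (s : E C -> Z)
    (h : E C + E C) :
  let S := connect (adj (avoid2 e (half_edge h))) (tgt e) in
  moves_chip e y g s -> half_end h = y -> half_edge h != e -> len (half_edge h) <> None ->
  S y -> ~~ S (half_end (half_opp h)) -> ~~ S (src e) ->
  exists g' s', moves_chip e (half_end (half_opp h)) g' s'.
Proof.
move=> S [gs se div gp] hy he hfin Sy Su Sp.
case ln: (len (half_edge h)) hfin => [n|] // _.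
(* Adding [n] on [S] changes the slope along [h], directed out of [S], by -1. Any other edge except
   [e] has both ends inside or both outside [S], and the slope on [e] is kept at 0. *)
exists (fun v => g v + Z.of_nat n * indic (S v))%Z.
exists (fun e' => s e' + (if e' == half_edge h then (if h is inl _ then -1 else 1) else 0))%Z.
have SE e' : e' != e -> e' != half_edge h -> S (src e') = S (tgt e').
  move=> e1 e2; have ok : avoid2 e (half_edge h) e' by rewrite /avoid2 e1 e2.
  apply/idP/idP; first exact: (@connect_edge _ _ _ (inl e')).
  exact: (@connect_edge _ _ _ (inr e')).
split.
- move=> e' e'e; move: (gs e' e'e); case: (eqVneq e' (half_edge h)) => [e'h|e'h].
    rewrite e'h ln; move/negPf: Su; move: Sy; rewrite -hy; clearbody S; clear -ln.
    by case: h ln => a /= _ -> -> ->; rewrite /indic; lia.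
  rewrite -SE //; case: (len e') => [m|]; lia.
- by rewrite eq_sym (negPf he) se.
- move=> v; rewrite (eq_bigr (fun h' => Z.add (half_sign s h')
    (Z.add (if h' == h then -1 else 0) (if h' == half_opp h then 1 else 0))%Z)); last first.
    move=> h' _; case: h {he hy ln S Sy Su Sp SE} => a; case: h' => b /=;
      rewrite ?(inj_eq inl_inj) ?(inj_eq inr_inj); case: eqP => _; lia.
  rewrite !big_split /= div !sum_half_delta hy; lia.
(* [tgt e] lies in [S] and is raised, while [src e] lies outside, so the inequality persists. *)
- by rewrite (negPf Sp) /S connect0 /indic; lia.
Qed.

(** Starting at [tgt e] with the zero function, the chip crosses one offending edge after another
    until [unfireable] holds. *)
Lemma exists_unfireable (C : tcurve) (e : E C) :
  connect (adj (predC1 e)) (tgt e) (src e) ->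
  exists y g s, moves_chip e y g s /\ (y = src e \/ unfireable e y).
Proof.
move=> qp.
have start : moves_chip e (tgt e) (fun=> 0%Z) (fun=> 0%Z).
  split=> [e' _||v|]; first by case: (len e').
  - by [].
  - by rewrite Z.sub_diag; apply: big1 => -[].
  - lia.
suff walk m : forall y l g s, (size l < m)%N -> path (adj (predC1 e)) y l ->
    src e = last y l -> moves_chip e y g s ->
    exists y g s, moves_chip e y g s /\ (y = src e \/ unfireable e y).
  by have [l pl lp] := connectP qp; apply: walk start; [exact: ltnSn|exact: pl|].
(* Each bridge crossed shortens a path from the chip to [src e]. *)
elim: m {start} => // m IH y l g s ml pl lp mv.
case: (classic (unfireable e y)) => [?|/not_all_ex_not[h]].
  by exists y, g, s; split=> //; right.
move=> bad; have [hy bad1] := imply_to_and _ _ bad; have [he bad2] := imply_to_and _ _ bad1.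
have [hfin bad3] := imply_to_and _ _ bad2; have [/negP nSp /negP nSu] := not_or_and _ _ bad3.
set S := connect _ (tgt e) in nSp nSu.
have Sok h' : half_edge h' != e -> half_edge h' != half_edge h ->
    S (half_end h') -> S (half_end (half_opp h')).
  by move=> h1 h2; apply: connect_edge; rewrite /avoid2 h1.
have Sq : S (tgt e) by apply: connect0.
(* Otherwise neither end of the edge of [h] would lie in [S], and [S] would be closed along all
   edges but [e], although it misses [src e]. *)
have Sy : S y.
  apply/negPn/negP => nSy; move/negP: nSp; apply.
  apply: (@connect_closed _ _ S _ _ _ qp Sq) => h' h'e.
  case: (eqVneq (half_edge h') (half_edge h)) => [/half_cases|]; last exact: Sok.
  by case=> ->; rewrite ?(negPf nSu) // hy (negPf nSy).
have [g' [s' mv']] := moves_chip_step mv hy he hfin Sy nSu nSp.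
(* The path runs from [S] to [src e] outside it and can leave [S] only across [h], so its tail
   starts where the chip arrives. *)
have [||l' [pl' ll' sl']] := @path_leaving C (predC1 e) S (half_end (half_opp h)) y l _ pl Sy.
- move=> a b /adjP[h' h'e [<- <-]] Sa nSb.
  case: (eqVneq (half_edge h') (half_edge h)) => [/half_cases|hh].
    case=> hE; rewrite hE //; move: nSb; rewrite hE.
    by case: (h) hy => x /= ->; rewrite Sy.
  by rewrite (Sok h') in nSb.
- by rewrite -lp.
by apply: IH mv'; [exact: leq_trans sl' _|exact: pl'|rewrite ll'].
Qed.

(** * Propagation of the maximum *)

(** Unlike in [inR], existence of the order is part of the condition. *)
Definition ord_ge (C : tcurve) (u : E C -> R -> R) (B : divisor C) : Prop :=
  forall x, valid x -> exists2 z, edge_ord u x z & (0 <= B x + z)%Z.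

Lemma sum_le0 (I : finType) (P : pred I) (o : I -> Z) :
  (forall i, P i -> o i <= 0)%Z -> (\big[Z.add/0%Z]_(i | P i) o i <= 0)%Z.
Proof. by move=> o0; apply: (big_ind (fun x => x <= 0)%Z) => // *; lia. Qed.

Lemma out_slope_zero (C : tcurve) (phi : E C -> R -> R) (h : E C + E C) (n : nat) :
  len (half_edge h) = Some n -> 0 < INR n ->
  (forall t, 0 <= t <= INR n -> phi (half_edge h) t = 0) -> out_slope phi h 0.
Proof.
case: h => e /= le n0 z; last rewrite le.
  by exists (INR n) => // h ?; rewrite !z; lra.
by exists (INR n) => // h ?; rewrite !z; lra.
Qed.

(** At a finite vertex where [phi] attains its maximum 0 the outgoing slopes are nonpositive with
    sum at least [-B], so all vanish, except perhaps one slope -1 at [y]. By convexity zeros spread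
    along edges, from [tgt e] through the graph without [e] and the lost edge. If [y] is unfireable,
    they reach [src e], or the far end of the lost edge, from where they would run back along it.
    From [src e] they continue along [e] to [t0]. *)
Lemma zero_propagates (C : tcurve) (e : E C) (L : nat) (t0 : R) (y : V C)
    (phi : E C -> R -> R) (phiV : V C -> R) (B : divisor C) :
  (forall e : E C, len e = None -> vdeg (tgt e) = 1%N) ->
  (forall (e : E C) n, len e = Some n -> 0 < INR n) ->
  len e = Some L -> 0 < t0 < INR L ->
  (forall e', phi e' 0 = phiV (src e')) ->
  (forall e' n, len e' = Some n -> phi e' (INR n) = phiV (tgt e')) ->
  (forall e', len e' = None -> phiV (tgt e') = phiV (src e')) ->
  (forall e' t, edge_dom e' t -> phi e' t <= 0) ->
  ord_ge phi B ->
  (forall e' t, e' <> e \/ t <> t0 -> B (PE e' t) <= 0)%Z ->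
  (forall v, B (PV v) <= indic ((v == y) && (y != src e)))%Z ->
  y = src e \/ unfireable e y ->
  connect (adj (predC1 e)) (tgt e) (src e) ->
  (forall t, t0 <= t <= INR L -> phi e t = 0) ->
  forall t, 0 <= t <= t0 -> phi e t = 0.
Proof.
move=> tip pos le t0L vs vt vi phi0 ob Be Bv ygood conn zr.
pose S v := phiV v = 0.
(* At a point at infinity [phiV] is only a stand-in, so the half-edge there is set aside. *)
pose regular (h : E C + E C) := if h is inr e then len e <> None else True.
(* A half-edge is lost when [phi] decreases along it from its maximum 0; the single chip at [y]
   allows at most one. *)
pose lost h := [/\ regular h, S (half_end h) & ~ out_slope phi h 0].
have reg_fin h : len (half_edge h) <> None -> regular h by case: h.
have finE (h : E C + E C) : len (half_edge h) <> None ->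
    exists2 n, len (half_edge h) = Some n & 0 < INR n.
  by case ln: (len (half_edge h)) => [n|] // _; exists n => //; apply: pos ln.
(* Away from the kink, [B] is nonpositive inside edges, which makes [phi] convex there. *)
have int e' t : e' <> e \/ t <> t0 -> valid (PE e' t) -> exists sr sl,
    right_slope (phi e') t sr /\ left_slope (phi e') t sl /\ (sl <= sr)%Z.
  move=> et /ob[z [sr [sl [Hr [Hl ->]]]]] Bz.
  by exists sr, sl; split=> //; split=> //; have := Be e' t et; lia.
have out_le0 h s : regular h -> S (half_end h) -> out_slope phi h s -> (s <= 0)%Z.
  case: h => e' /= reg Sv.
    have [b [b0 dom]] : exists b, 0 < b /\ forall t, 0 < t < b -> edge_dom e' t.
      rewrite /edge_dom; case ln: (len e') => [n|].
        by exists (INR n); split=> [|t ?]; [exact: pos ln|lra].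
      by exists 1; split=> [|t ?]; [lra|split=> //; lra].
    apply: (right_slope_le0 b0); last by rewrite vs.
    by move=> t tb; apply: phi0; apply: dom.
  case ln: (len e') reg => [n|] // _ ls; suff : (0 <= - s)%Z by lia.
  apply: (left_slope_ge0 (pos _ _ ln)) ls; last by rewrite (vt _ _ ln).
  by move=> t tn; apply: phi0; rewrite /edge_dom ln; lra.
have vertex h1 : regular h1 -> S (half_end h1) -> exists o,
    [/\ forall h, half_end h = half_end h1 -> out_slope phi h (o h) /\ (o h <= 0)%Z
      & (0 <= B (PV (half_end h1))
              + \big[Z.add/0%Z]_(h | half_end h == half_end h1) o h)%Z].
  move=> reg Sh; have [//|z [o Ho ->] Bz] := ob (PV (half_end h1)).
  exists o; split=> // h hv; split; first exact: Ho.
  apply: out_le0 (Ho h hv); last by rewrite hv.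
  case: h hv => //= e' e'v ln; move: reg.
  by rewrite (tip_half (tip e' ln) (esym e'v)) /= ln.
have lost_y h : lost h -> half_end h = y /\ y <> src e.
  move=> [reg Sh nz]; have [o [Ho]] := vertex h reg Sh.
  have [Hh oh] := Ho h erefl.
  have oh0 : o h <> 0%Z by move=> oh0; apply: nz; rewrite -oh0.
  rewrite (bigD1 h) //=; set rest := \big[_/_]_(_ | _) _.
  have : (rest <= 0)%Z by apply: sum_le0 => h' /andP[/eqP /Ho[]].
  move: (Bv (half_end h)); rewrite /indic.
  case: eqP => [<-|_ /=]; last lia.
  by case: eqP => /=; [lia|].
have lost_unique h1 h2 : lost h1 -> lost h2 -> h1 = h2.
  move=> l1 l2; apply/eqP/negPn/negP => h12.
  have [h1y yp] := lost_y _ l1; have [h2y _] := lost_y _ l2.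
  case: l1 l2 => [reg1 S1 nz1] [reg2 S2 nz2].
  have [o [Ho]] := vertex h1 reg1 S1.
  have [[H1 o1] [H2 o2]] := (Ho h1 erefl, Ho h2 (etrans h2y (esym h1y))).
  have o10 : o h1 <> 0%Z by move=> oh0; apply: nz1; rewrite -oh0.
  have o20 : o h2 <> 0%Z by move=> oh0; apply: nz2; rewrite -oh0.
  rewrite (bigD1 h1) //= (bigD1 h2) /=; last by rewrite h1y h2y eqxx eq_sym.
  set rest := \big[_/_]_(_ | _) _.
  have : (rest <= 0)%Z by apply: sum_le0 => h' /andP[/andP[/eqP /Ho[]]].
  by move: (Bv (half_end h1)); rewrite /indic; case: ifP; lia.
(* A zero with outgoing slope 0 spreads over the whole edge by convexity. *)
have transfer h : half_edge h <> e -> len (half_edge h) <> None -> S (half_end h) ->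
    out_slope phi h 0 -> S (half_end (half_opp h)) /\ out_slope phi (half_opp h) 0.
  move=> he hfin Sh oh; have [n ln n0] := finE h hfin.
  have [z [o Ho _] _] := ob (PV (half_end (half_opp h))) I.
  have {Ho} oo := Ho (half_opp h) erefl.
  have zero t : 0 <= t <= INR n -> phi (half_edge h) t = 0.
    have h0 t' : 0 <= t' <= INR n -> phi (half_edge h) t' <= 0.
      by move=> ?; apply: phi0; rewrite /edge_dom ln.
    have hint t' : 0 < t' < INR n -> exists sr sl, right_slope (phi (half_edge h)) t' sr /\
        left_slope (phi (half_edge h)) t' sl /\ (sl <= sr)%Z.
      by move=> [? ?]; apply: int; [left|rewrite /= ln].
    case: h he hfin Sh oh ln oo h0 hint => a /= ae _ Sa oa ln oo h0 hint.
      apply: convex_zero => //; first by rewrite vs.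
      by move: oo; rewrite ln; exists (- o (inr a))%Z.
    rewrite ln in oa.
    apply: convex_zero_left => //; first by rewrite (vt _ _ ln).
    by exists (o (inl a)).
  split; last by apply: (out_slope_zero (n := n)); rewrite ?half_opp_edge.
  case: h ln zero {he hfin Sh oh oo} => a /= ln zero; rewrite /S.
    by rewrite -(vt _ _ ln) zero //; lra.
  by rewrite -vs zero //; lra.
have spread (ok : pred (E C)) :
    (forall h, ok (half_edge h) -> half_edge h <> e /\
       (len (half_edge h) <> None -> ~ lost h)) ->
    forall v, connect (adj ok) (tgt e) v -> S v.
  move=> okP v qv; apply: (connect_closed _ qv); last first.
    by rewrite /S -(vt _ _ le) zr //; lra.
  move=> h /okP[he nl] Sh.
  case ln: (len (half_edge h)) => [n|]; last first.
    by case: h {he nl} Sh ln => a /= Sa ln; rewrite /S ?vi // -vi.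
  have fin : len (half_edge h) <> None by rewrite ln.
  apply: (proj1 (transfer h he fin Sh _)).
  by apply: NNPP => nz; apply: (nl fin); split=> //; apply: reg_fin.
have e_zero : out_slope phi (inr e) 0.
  rewrite /= le; exists (INR L - t0); first lra.
  by move=> h ?; rewrite !zr; lra.
have Sp : S (src e).
  have noloss : (forall h, half_edge h <> e -> len (half_edge h) <> None -> ~ lost h) -> S (src e).
    move=> nl; apply: (spread (predC1 e)) => // h /eqP he; split=> // fin.
    exact: nl.
  case: (classic (exists2 h, half_edge h <> e /\ len (half_edge h) <> None & lost h)); last first.
    by move=> nl; apply: noloss => h he fin lh; apply: nl; exists h.
  move=> [h [/eqP he hfin] lh]; have [hy yp] := lost_y h lh.
  case: ygood => [//|/(_ h hy he hfin) good].
  have reach v : connect (adj (avoid2 e (half_edge h))) (tgt e) v -> S v.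
    apply: spread => h' /andP[/eqP h'e /eqP h'h]; split=> // _ lh'.
    by apply: h'h; rewrite (lost_unique _ _ lh' lh).
  case: good => [/reach //|/reach Su].
  (* The single possible loss is [h], so zeros return along the edge from its far end, and [h]
     cannot be lost after all. *)
  have nl : ~ lost (half_opp h).
    by move=> lo; have := lost_unique _ _ lo lh; case: (h).
  have oz : out_slope phi (half_opp h) 0.
    apply: NNPP => nz; apply: nl; split=> //; apply: reg_fin.
    by rewrite half_opp_edge.
  have [||_ hz] := transfer (half_opp h) _ _ Su oz; try by rewrite half_opp_edge.
    by rewrite half_opp_edge; apply/eqP.
  by case: lh => _ _; case: (h) hz.
(* A lost half-edge starts at [y], which then differs from [src e]; so [e] is not lost at
   [src e]. *)
have p_zero : out_slope phi (inl e) 0.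
  apply: NNPP => nz; have [//|+ yp] := lost_y (inl e) _.
  by move=> /= py; apply: yp.
apply: convex_zero => //; first lra.
- by move=> t tb; apply: phi0; rewrite /edge_dom le; lra.
- by rewrite vs.
- by move=> t tb; apply: int; [right; lra|rewrite /= le; lra].
- have [|z [sr [sl [_ [Hl _]]]] _] := ob (PE e t0); first by rewrite /= le; lra.
  by exists sl.
Qed.

(** * Edges that are not bridges *)

Lemma nonbridge_connected (C : tcurve) (e : E C) (u v : V C) :
  ~ is_bridge e -> connect (adj (predC1 e)) u v.
Proof. by move=> /NNPP; apply. Qed.

(** The tip of an infinite edge has no other half-edge, so it is isolated once [e] is removed;
    connectedness would make [e] a loop at a one-valent vertex. *)
Lemma nonbridge_finite (C : tcurve) (e : E C) :
  (forall e : E C, len e = None -> vdeg (tgt e) = 1%N) ->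
  ~ is_bridge e -> exists n, len e = Some n.
Proof.
move=> tip /(@nonbridge_connected _ _ (tgt e) (src e)) conn.
case le: (len e) => [n|]; first by exists n.
have := tip e le => deg; have tipE h := @tip_half _ _ h deg.
suff : src e = tgt e by move=> /(tipE (inl e)).
apply: (connect_closed (S := fun v => v = tgt e) _ conn erefl) => h /negP he hv.
by case: he; rewrite (tipE h hv).
Qed.

(** * Tropical monomials *)

Definition affine_on (g : R -> R) (a b : R) : Prop :=
  exists m c, forall t, a < t < b -> g t = c + m * t.

Lemma affine_on_lin (x y : R) (f g : R -> R) (a b : R) :
  affine_on f a b -> affine_on g a b -> affine_on (fun t => x * f t + y * g t) a b.
Proof.
move=> [m1 [c1 H1]] [m2 [c2 H2]]; exists (x * m1 + y * m2), (x * c1 + y * c2) => t tab.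
rewrite H1 // H2 //; lra.
Qed.

Lemma affine_on_sum (N : nat) (mo : nat -> R) (g : nat -> R -> R) (a b : R) :
  (forall i, (i < N)%N -> affine_on (g i) a b) ->
  affine_on (fun t => \big[Rplus/0]_(i < N) (mo i * g i t)) a b.
Proof.
elim: N => [|N IH] aff; first by exists 0, 0 => t _; rewrite big_ord0; lra.
have [|m [c H]] := @affine_on_lin 1 (mo N) _ (g N) a b (IH _) (aff N (ltnSn N)).
  by move=> i iN; apply/aff/ltnW.
by exists m, c => t tab; rewrite -H // big_ord_recr /=; lra.
Qed.

Lemma affine_on_subset (g : R -> R) (a a' b : R) :
  a <= a' -> affine_on g a b -> affine_on g a' b.
Proof. by move=> aa' [m [c H]]; exists m, c => t ?; apply: H; lra. Qed.

(** Finitely many left germs at [b] have a common interval. Finiteness of the set of generators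
    enters here. *)
Lemma left_slopes_affine (N : nat) (g : nat -> R -> R) (b : R) :
  (forall i, (i < N)%N -> exists s, left_slope (g i) b s) ->
  exists2 a, a < b & forall i, (i < N)%N -> affine_on (g i) a b.
Proof.
elim: N => [|N IH] ls; first by exists (b - 1) => //; lra.
have [|a ab aff] := IH; first by move=> i iN; apply/ls/ltnW.
have [s [eps e0 H]] := ls N (ltnSn N).
exists (Rmax a (b - eps)); first by apply: Rmax_lub_lt; lra.
have ? := Rmax_l a (b - eps); have ? := Rmax_r a (b - eps).
move=> i; rewrite ltnS leq_eqVlt => /orP[/eqP ->|iN].
  exists (IZR s), (g N b - IZR s * b) => t tb.
  have -> : t = b - (b - t) by lra.
  rewrite H; lra.
by apply: affine_on_subset (aff i iN).
Qed.

(** The default value [F 0%N] is one of the terms, so it does not change the maximum. *)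
Lemma big_Rmax (F : nat -> R) (J : nat) (m := \big[Rmax/F 0%N]_(j < J.+1) F j) :
  (forall j, (j <= J)%N -> F j <= m) /\ exists2 j, (j <= J)%N & m = F j.
Proof.
have seqP (r : seq 'I_J.+1) (n := \big[Rmax/F 0%N]_(j <- r) F j) :
    (forall j, j \in r -> F j <= n) /\ exists2 j : 'I_J.+1, True & n = F j.
  rewrite {}/n; elim: r => [|i r [ub att]]; first by split=> //; rewrite big_nil; exists ord0.
  rewrite big_cons; set n := \big[_/_]_(_ <- _) _ in ub att *.
  have ? := Rmax_l (F i) n; have ? := Rmax_r (F i) n.
  split=> [j|]; last by rewrite /Rmax; case: Rle_dec => _ //; exists i.
  by rewrite inE => /orP[/eqP -> //|/ub ?]; lra.
have [ub [j _ mj]] := seqP (index_enum 'I_J.+1).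
split=> [i iJ|]; last by exists j => //; rewrite -ltnS; apply: ltn_ord.
by apply: (ub (Ordinal (iJ : (i < J.+1)%N))); apply: mem_index_enum.
Qed.

Lemma ord_ge_const (C : tcurve) (c : R) (u : E C -> R -> R) (B : divisor C) :
  ord_ge u B -> ord_ge (fun e t => c + u e t) B.
Proof.
move=> H x /H[z uz Bz]; exists z => //.
have := edge_ord_lin 1 1 (edge_ord_const c x) uz.
have -> : (1 * 0 + 1 * z)%Z = z by lia.
by apply: edge_ord_ext => e t; lra.
Qed.

Lemma ord_ge_sum (C : tcurve) (D : divisor C) (N : nat) (mo dg : nat -> nat)
    (w : nat -> E C -> R -> R) :
  (forall i, (i < N)%N -> ord_ge (w i) (scale_div (dg i) D)) ->
  ord_ge (fun e t => \big[Rplus/0]_(i < N) (INR (mo i) * w i e t))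
         (scale_div (\sum_(i < N) mo i * dg i)%N D).
Proof.
elim: N => [|N IH] H x vx.
  exists 0%Z; last by rewrite /scale_div big_ord0; lia.
  by apply: edge_ord_ext (edge_ord_const 0 x) => e t; rewrite big_ord0.
have [|z1 H1 B1] := IH _ x vx; first by move=> i iN; apply/H/ltnW.
have [z2 H2 B2] := H N (ltnSn N) x vx.
exists (1 * z1 + Z.of_nat (mo N) * z2)%Z.
  apply: edge_ord_ext (edge_ord_lin 1 (Z.of_nat (mo N)) H1 H2) => e t.
  by rewrite big_ord_recr /= INR_IZR_INZ; lra.
have := Z.mul_nonneg_nonneg _ _ (Zle_0_nat (mo N)) B2.
move: B1; rewrite Z.mul_1_l /scale_div big_ord_recr /= Nat2Z.inj_add Nat2Z.inj_mul; lia.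
Qed.

Lemma inR_ord_ge (C : tcurve) (D : divisor C) (f : pt C -> Rbar) :
  (forall (e : E C) n, len e = Some n -> 0 < INR n) ->
  inR D f -> ord_ge (edge_fun f) D.
Proof.
move=> pos [rf H] x vx; have [z fz] := rational_ord pos rf vx.
by exists z => //; apply: H => //; apply: edge_ord_ord_rel.
Qed.

(** Transfers the maximum formula of [fin_generated], stated at [fin_pt], to edge parameters; by
    valence one no finite parameter meets a point at infinity. *)
Lemma edge_dom_point (C : tcurve) (e : E C) (t : R) :
  (forall e : E C, len e = None -> vdeg (tgt e) = 1%N) -> edge_dom e t ->
  exists2 x, fin_pt x & forall f, Defs.fe f e t = f x.
Proof.
move=> tip [t0 tn]; rewrite /Defs.fe; case: Req_EM_T => [?|tz].
  exists (PV (src e)) => //; split=> // e' inf [sE].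
  by have := @tip_half _ e' (inl e) (tip _ inf) sE.
case ln: (len e) tn => [n|] tn; last first.
  by exists (PE e t) => //; split=> //=; rewrite ln; split=> //; lra.
case: Req_EM_T => [?|tnn]; last by exists (PE e t) => //; split=> //=; rewrite ln; lra.
exists (PV (tgt e)) => //; split=> // e' inf [sE].
by apply: (@finite_end_not_tip _ (inr e) e' tip) sE => //=; rewrite ln.
Qed.

(** * Adding edgewise data to a rational function *)

Lemma pl_on_affine (g : R -> R) (a b x : R) (c : Z) :
  pl_on g a b -> pl_on (fun t => x + IZR c * g t) a b.
Proof.
move=> [k [p [s [p0 [pk [inc lin]]]]]]; exists k, p, (fun i => c * s i)%Z.
do 3 split=> //; move=> i t ik tp; rewrite (lin i t ik tp) mult_IZR; lra.
Qed.

(* [w + c F] as a function on points; for [c < 0] the infinite values of [F] change sign. *)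
Definition combine (C : tcurve) (w : E C -> R -> R) (g : V C -> Z) (c : Z)
    (F : pt C -> Rbar) (x : pt C) : Rbar :=
  match x with
  | PV v => match F (PV v) with
            | Rbar.Finite r => Rbar.Finite (IZR (g v) + IZR c * r)
            | p_infty => m_infty
            | m_infty => p_infty
            end
  | PE e t => Rbar.Finite (w e t + IZR c * real (F (PE e t)))
  end.

(** On an infinite edge [w] must be constant, so that [F] alone decides whether [combine] is
    infinite at the tip. *)
Definition extends (C : tcurve) (w : E C -> R -> R) (g : V C -> Z) : Prop :=
  forall e, w e 0 = IZR (g (src e)) /\
    match len e with
    | Some n => w e (INR n) = IZR (g (tgt e))
    | None => forall t, w e t = IZR (g (tgt e))
    end.

Lemma combine_fe (C : tcurve) (w : E C -> R -> R) (g : V C -> Z) (c : Z)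
    (F : pt C -> Rbar) (e : E C) (t : R) :
  is_rational F -> extends w g ->
  Defs.fe (combine w g c F) e t = Rbar.Finite (w e t + IZR c * edge_fun F e t).
Proof.
move=> rF /(_ e)[w0 wn].
have := @rational_finite _ F e t rF; rewrite /edge_dom /edge_fun /Defs.fe.
case: Req_EM_T => [t0 /=|t0 /=].
  case: (len e) => [n|] fin; rewrite fin ?t0 ?w0 //; split=> //; try lra.
  exact: pos_INR.
case ln: (len e) wn => [n|] wn // fin; case: Req_EM_T fin => [tn /=|//] fin.
by rewrite fin ?tn ?wn //; have := pos_INR n; lra.
Qed.

Lemma combine_edge_fun (C : tcurve) (w : E C -> R -> R) (g : V C -> Z) (c : Z)
    (F : pt C -> Rbar) (e : E C) (t : R) :
  is_rational F -> extends w g ->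
  edge_fun (combine w g c F) e t = IZR 1 * w e t + IZR c * edge_fun F e t.
Proof. by move=> rF wg; rewrite {1}/edge_fun combine_fe //=; lra. Qed.

(** On finite edges one-sided slopes suffice for piecewise linearity; on infinite ones [w] is
    constant and the sign of [c * s] decides the value at infinity. *)
Lemma combine_rational (C : tcurve) (w : E C -> R -> R) (g : V C -> Z) (c : Z)
    (F : pt C -> Rbar) :
  (forall (e : E C) n, len e = Some n -> 0 < INR n) ->
  is_rational F -> extends w g -> (c < 0)%Z ->
  (forall x, valid x -> exists z, edge_ord w x z) ->
  is_rational (combine w g c F).
Proof.
move=> pos rF wg c0 word e; case le: (len e) => [n|].
  exists (fun t => IZR 1 * w e t + IZR c * edge_fun F e t); split; last first.
    by move=> t _; rewrite combine_fe //; congr Rbar.Finite; lra.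
  have n0 := pos e n le; apply: slopes_pl_on => [|t tn|t tn]; first lra.
    have [||s2 H2] := @rational_right_slope _ F e t rF; rewrite ?le; try lra.
    have [s1 H1] : exists s, right_slope (w e) t s.
      case: (Req_dec t 0) => [->|t0].
        by have [z [o Ho _]] := word (PV (src e)) I; exists (o (inl e)); apply: (Ho (inl e)).
      have [|z [sr [sl [Hr _]]]] := word (PE e t); first by rewrite /= le; lra.
      by exists sr.
    by exists (1 * s1 + c * s2)%Z; apply: right_slope_lin.
  have [||s2 H2] := @rational_left_slope _ F e t rF; rewrite ?le; try lra.
  have [s1 H1] : exists s, left_slope (w e) t s.
    case: (Req_dec t (INR n)) => [->|t0].
      have [z [o Ho _]] := word (PV (tgt e)) I; exists (- o (inr e))%Z.
      by have := Ho (inr e) erefl; rewrite /= le.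
    have [|z [sr [sl [_ [Hl _]]]]] := word (PE e t); first by rewrite /= le; lra.
    by exists sl.
  by exists (1 * s1 + c * s2)%Z; apply: left_slope_lin.
have := rF e; rewrite le => -[gF [M [s [M0 [gpl [gM [gfin gtip]]]]]]].
have [_] := wg e; rewrite le => wc.
exists (fun t => IZR (g (tgt e)) + IZR c * gF t), M, (c * s)%Z; split=> //.
split; first exact: pl_on_affine.
split; first by move=> t tM; rewrite gM // mult_IZR; lra.
split; first by move=> t t0; rewrite combine_fe // wc /edge_fun gfin.
have T a b : (a < b)%Z -> (a <? b)%Z = true by move/Z.ltb_lt.
have N a b : (b <= a)%Z -> (a <? b)%Z = false by move/Z.ltb_ge.
rewrite /combine gtip; case: (Z.lt_trichotomy s 0) => [s0|[->|s0]].
- by rewrite (N 0%Z s) ?(T s 0%Z) ?(T 0%Z) //; nia.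
- by rewrite Z.mul_0_r.
- by rewrite (T 0%Z s) // (N 0%Z) ?(T (c * s)%Z) //; nia.
Qed.

(** * The witness in R(MD) *)

(** With [g] and [s] from [moves_chip], this draws [a] chips from [src e] and [b] from [tgt e] to
    the point [t0], besides the move from [tgt e] to [y]. *)
Definition kink (C : tcurve) (e : E C) (g : V C -> Z) (s : E C -> Z) (a b : Z) (t0 : R)
    (e' : E C) (t : R) : R :=
  if e' == e then
    IZR (g (src e)) + (if Rle_dec t t0 then - IZR a * t else - IZR a * t0 + IZR b * (t - t0))
  else IZR (g (src e')) + IZR (s e') * t.

Definition kink_div (C : tcurve) (e : E C) (y : V C) (a b : Z) (t0 : R) : divisor C :=
  fun x => match x with
  | PV v => (indic (v == y) - indic (v == tgt e)
             - a * indic (v == src e) - b * indic (v == tgt e))%Z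
  | PE e' t => if e' == e then (if Req_EM_T t t0 then (a + b)%Z else 0%Z) else 0%Z
  end.

Lemma kink_left (C : tcurve) (e : E C) (g : V C -> Z) (s : E C -> Z) (a b : Z) (t0 t : R) :
  t <= t0 -> kink e g s a b t0 e t = IZR (g (src e)) - IZR a * t.
Proof. by rewrite /kink eqxx; case: Rle_dec => // _ _ /=; lra. Qed.

Lemma kink_right (C : tcurve) (e : E C) (g : V C -> Z) (s : E C -> Z) (a b : Z) (t0 t : R) :
  t0 <= t -> kink e g s a b t0 e t = IZR (g (src e)) - IZR a * t0 + IZR b * (t - t0).
Proof.
move=> tt; case: (Req_dec t t0) => [->|?]; first by rewrite kink_left; lra.
by rewrite /kink eqxx; case: Rle_dec => [?|? /=]; lra.
Qed.

Lemma kink_extends (C : tcurve) (e : E C) (y : V C) (g : V C -> Z) (s : E C -> Z) (a b : Z)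
    (t0 : R) (L : nat) :
  moves_chip e y g s -> len e = Some L -> 0 < t0 < INR L ->
  IZR (g (tgt e)) = IZR (g (src e)) - IZR a * t0 + IZR b * (INR L - t0) ->
  extends (kink e g s a b t0) g.
Proof.
move=> [gs _ _ _] le t0L gq e'; case: (eqVneq e' e) => [->|e'e].
  by rewrite le kink_left ?kink_right; lra.
rewrite /kink (negPf e'e); split; first lra.
move: (gs e' e'e); case: (len e') => [n ->|[-> ->] t]; last lra.
by rewrite plus_IZR mult_IZR -INR_IZR_INZ.
Qed.

Lemma kink_ord (C : tcurve) (e : E C) (y : V C) (g : V C -> Z) (s : E C -> Z) (a b : Z)
    (t0 : R) (L : nat) (x : pt C) :
  moves_chip e y g s -> len e = Some L -> 0 < t0 < INR L -> valid x ->
  edge_ord (kink e g s a b t0) x (kink_div e y a b t0 x).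
Proof.
move=> [gs se div _] le t0L vx.
have Rlt_ t : t < t0 -> right_slope (kink e g s a b t0 e) t (- a).
  by move=> tt; exists (t0 - t) => [|h ?]; rewrite ?kink_left ?opp_IZR; lra.
have Rge t : t0 <= t -> right_slope (kink e g s a b t0 e) t b.
  by move=> tt; exists 1 => [|h ?]; rewrite ?kink_right; lra.
have Lle t : t <= t0 -> left_slope (kink e g s a b t0 e) t (- a).
  by move=> tt; exists 1 => [|h ?]; rewrite ?kink_left ?opp_IZR; lra.
have Lgt t : t0 < t -> left_slope (kink e g s a b t0 e) t b.
  by move=> tt; exists (t - t0) => [|h ?]; rewrite ?kink_right; lra.
have Rne e' t : e' != e -> right_slope (kink e g s a b t0 e') t (s e').
  move=> /negPf e'e; exists 1; first lra.
  by move=> h ?; rewrite /kink e'e; lra.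
have Lne e' t : e' != e -> left_slope (kink e g s a b t0 e') t (s e').
  move=> /negPf e'e; exists 1; first lra.
  by move=> h ?; rewrite /kink e'e; lra.
case: x vx => [v _|e' t] /=; last first.
  case: (eqVneq e' e) => [-> |e'e _]; last first.
    by exists (s e'), (s e'); split; [exact: Rne|split; [exact: Lne|lia]].
  rewrite le => tL; case: Req_EM_T => [tt|tt] /=.
    by exists b, (- a)%Z; split; [apply: Rge; lra|split; [apply: Lle; lra|lia]].
  case: (Rlt_le_dec t t0) => tt0.
    by exists (- a)%Z, (- a)%Z; split; [exact: Rlt_|split; [apply: Lle; lra|lia]].
  by exists b, b; split; [exact: Rge|split; [apply: Lgt; lra|lia]].
exists (fun h => half_sign s h +
  ((if h == inl e then - a else 0) + (if h == inr e then - b else 0)))%Z; last first.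
  by rewrite !big_split /= div !sum_half_delta /=; lia.
move=> [e'|e'] _; rewrite /= ?(inj_eq inl_inj) ?(inj_eq inr_inj).
  case: (eqVneq e' e) => [->|e'e]; last by rewrite !Z.add_0_r; apply: Rne.
  by rewrite se Z.add_0_r; apply: Rlt_; lra.
case: (eqVneq e' e) => [->|e'e].
  by rewrite le se Z.opp_involutive; apply: Lgt; lra.
rewrite Z.add_0_r Z.opp_involutive; case ln: (len e') => [n|]; first exact: Lne.
by exists 0 => t _; rewrite /kink (negPf e'e); lra.
Qed.

(* Replaces a point at infinity by the other end of its edge, where functions are finite. *)
Definition anchor (C : tcurve) (v : V C) : V C :=
  if [pick e : E C | (len e == None) && (tgt e == v)] is Some e then src e else v.

Lemma anchor_not_tip (C : tcurve) (v : V C) :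
  (forall e : E C, len e = None -> v <> tgt e) -> anchor v = v.
Proof.
rewrite /anchor => nt; case: pickP => // e /andP[/eqP /nt vt /eqP tv].
by case: vt.
Qed.

Lemma anchor_tip (C : tcurve) (e : E C) :
  vdeg (tgt e) = 1%N -> len e = None -> anchor (tgt e) = src e.
Proof.
rewrite /anchor => deg inf; case: pickP => [e' /andP[_ /eqP tE]|/(_ e)].
  by have [->] := @tip_half _ e (inr e') deg tE.
by rewrite inf !eqxx.
Qed.

(** [A] is the prescribed increase along an edge of length [2 * l]. Solving for [t0] gives [l - t0 =
    ((1 + d) * l + A) / (2 * m * k - 1 + d)], which is positive and tends to 0 as [m] grows. *)
Lemma kink_position (l A eta : R) (k : Z) (d : Z) :
  0 < l -> 0 <= A -> 0 < eta -> (0 < k)%Z -> (0 <= d)%Z ->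
  exists (m : nat) (t0 : R), (0 < m)%N /\ l - eta < t0 < l /\ 0 < t0 /\
    A = - IZR (Z.of_nat m * k + d) * t0 + IZR (Z.of_nat m * k - 1) * (2 * l - t0).
Proof.
move=> l0 A0 eta0 k0 d0.
have cpos : 0 < (1 + IZR d) * l + A.
  by have := IZR_le _ _ d0; nra.
set c := (_ + A) in cpos.
(* The cap [l] keeps [t0] positive. *)
pose eta' := Rmin eta l.
have eta'0 : 0 < eta' by apply: Rmin_glb_lt.
have [m Hm] := INR_unbounded (c / eta' + 1).
have ce : 0 < c / eta' by apply: Rdiv_lt_0_compat.
have m0 : (0 < m)%N by case: m Hm => //=; lra.
have m1 : 1 < INR m by lra.
have k1 : 1 <= IZR k by apply: IZR_le; lia.
have d0' : 0 <= IZR d by apply: IZR_le.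
set q := 2 * (INR m * IZR k) - 1 + IZR d.
have qm : INR m <= q by rewrite /q; nra.
have cq : c / q < eta'.
  apply: (Rmult_lt_reg_r q); first lra.
  have -> : c / q * q = c by field; lra.
  have : c / eta' * eta' = c by field; lra.
  nra.
have ? := Rmin_l eta l; have ? := Rmin_r eta l.
have cq0 : 0 < c / q by apply: Rdiv_lt_0_compat; lra.
exists m, (l - c / q); split=> //; split; first by rewrite /eta' in cq; lra.
split; first by rewrite /eta' in cq; lra.
rewrite plus_IZR minus_IZR mult_IZR -INR_IZR_INZ.
have : c / q * q = c by field; lra.
rewrite /q {2}/c; nra.
Qed.

Lemma affine_max_zero (m c x y z : R) :
  x < y < z -> c + m * y = 0 -> (forall t, x <= t < z -> c + m * t <= 0) -> m = 0.
Proof.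
move=> xyz y0 le0; have h1 := le0 x; have h2 := le0 ((y + z) / 2).
apply: Rle_antisym.
  by apply: (Rmult_le_reg_r (z - y)); lra.
by apply: (Rmult_le_reg_r (y - x)); lra.
Qed.

(** * Contradiction from finitely many generators *)

Theorem theorem2p7 (C : tcurve) (D : divisor C) (d : Z) :
  is_Ztrop_curve C ->
  (2 <= genus C)%Z ->
  is_Zdivisor D ->
  has_degree D d ->
  (2 <= d)%Z ->
  (exists (e : E C) (n : nat) (k : Z),
      (0 < n)%N /\ ~ is_bridge e /\
      (Z.of_nat n * d = 2 * k)%Z /\
      lin_equiv (scale_div n D) (two_pt_div k (src e) (tgt e))) ->
  ~ fin_generated D.
Proof.
move=> [_ [_ [lenpos tip]]] _ _ _ d2 [e [n [k [n0 [nbr [nd [F [rF divF]]]]]]]].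
have pos (e' : E C) m : len e' = Some m -> 0 < INR m.
  by move=> /lenpos m0; apply: lt_0_INR; apply/ltP.
have k0 : (0 < k)%Z by move/ltP: n0 => n0; nia.
have [L le] := nonbridge_finite tip nbr.
have L0 := pos _ _ le.
have conn : connect (adj (predC1 e)) (tgt e) (src e) by apply: nonbridge_connected.
have ordF x : valid x ->
    edge_ord (edge_fun F) x (scale_div n D x - two_pt_div k (src e) (tgt e) x)%Z.
  move=> vx; have [z Fz] := rational_ord pos rF vx.
  by rewrite (divF x vx z) //; apply: edge_ord_ord_rel.
move=> [N [dg [gen [genR span]]]].
have [y [g [s [mv ygood]]]] := exists_unfireable conn.
have mid_valid : valid (PE e (INR L / 2)) by rewrite /= le; lra.
(* Index 0 is [F] and index [i + 1] the generator [i]: all are affine between [c] and the midpoint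
   of [e]. *)
have [c cL aff] : exists2 c, c < INR L / 2 & forall i, (i < N.+1)%N ->
    affine_on (if i is i'.+1 then edge_fun (gen i') e else edge_fun F e) c (INR L / 2).
  apply: (left_slopes_affine (g := fun i =>
    if i is i'.+1 then edge_fun (gen i') e else edge_fun F e)) => -[|i] iN.
    by have [sr [sl [_ [Hl _]]]] := ordF _ mid_valid; exists sl.
  by have [z [sr [sl [_ [Hl _]]]] _] := inR_ord_ge pos (genR i iN) mid_valid; exists sl.
(* If the chip arrives at [src e], it joins the chips sent from there into [e]. *)
pose dl := indic (y == src e).
have dl0 : (0 <= dl)%Z by rewrite /dl /indic; case: ifP.
have gpq : (g (src e) <= g (tgt e))%Z by case: mv.
(* The margin [INR L / 2 - c] places the kink where [F] and the generators are affine. *)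
have [|||||m [t0 [m0 [t0L [t00 At0]]]]] :=
    @kink_position (INR L / 2) (IZR (g (tgt e)) - IZR (g (src e))) (INR L / 2 - c) k dl;
  try (by []); try lra.
  by have := IZR_le _ _ gpq; lra.
have t0L' : 0 < t0 < INR L by lra.
set a := (_ + dl)%Z in At0; set b := (_ - 1)%Z in At0.
pose w := kink e g s a b t0.
have wg : extends w g by apply: (kink_extends mv le t0L'); lra.
have ordw x : valid x -> edge_ord w x (kink_div e y a b t0 x) by apply: kink_ord mv le t0L'.
pose M := Z.of_nat m; have M0 : (0 < M)%Z by move/ltP: m0; rewrite /M; lia.
pose H := combine w g (- M)%Z F.
have rH : is_rational H.
  apply: combine_rational => //; first lia.
  by move=> x vx; exists (kink_div e y a b t0 x); apply: ordw.
have HE e' t : edge_fun H e' t = IZR 1 * w e' t + IZR (- M) * edge_fun F e' t.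
  exact: combine_edge_fun.
(* The divisor of [H] plus [m * n] times [D]: [F] trades [D] for chips at both ends of [e], and [w]
   gathers them at [t0], up to at most one left at [y]. *)
pose B x := (M * two_pt_div k (src e) (tgt e) x + kink_div e y a b t0 x)%Z.
have ordH x : valid x -> edge_ord (edge_fun H) x (B x - scale_div (m * n) D x)%Z.
  move=> vx; have := edge_ord_lin 1 (- M) (ordw x vx) (ordF x vx).
  move=> /(edge_ord_ext (fun e t => esym (HE e t))); congr edge_ord.
  by rewrite /B /scale_div Nat2Z.inj_mul /M; lia.
have BV v : B (PV v) = (indic (v == y) - dl * indic (v == src e))%Z.
  by rewrite /B /= /a /b -/M /indic; case: (v == src e); case: (v == tgt e); lia.
have BE e' t : B (PE e' t) = kink_div e y a b t0 (PE e' t).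
  by rewrite /B /= Z.mul_0_r.
have HR : inR (scale_div (m * n) D) H.
  split=> // x vx z /ord_rel_edge_ord Hz; rewrite (edge_ord_unique Hz (ordH x vx)).
  suff : (0 <= B x)%Z by lia.
  case: x {vx Hz} => [v|e' t].
    rewrite BV /dl /indic; case: (eqVneq v y) => [->|vy]; first by case: eqP.
    by case: (eqVneq v (src e)) => [vE|_]; [rewrite -vE eq_sym (negPf vy)|lia].
  by rewrite BE /=; do 2 case: ifP => // _; lia.
have [J [cst [mono [deg HJ]]]] := span _ H HR.
pose u j e' t := cst j + \big[Rplus/0]_(i < N) (INR (mono j i) * edge_fun (gen i) e' t).
have Hmax e' t : edge_dom e' t -> (forall j, (j <= J)%N -> u j e' t <= edge_fun H e' t) /\
    exists2 j, (j <= J)%N & edge_fun H e' t = u j e' t.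
  move=> /(edge_dom_point tip)[x xfin xE].
  pose v j := cst j + \big[Rplus/0]_(i < N) (INR (mono j i) * real (gen i x)).
  have uv j : u j e' t = v j.
    by congr Rplus; apply: eq_bigr => i _; rewrite /edge_fun xE.
  rewrite {1 2}/edge_fun xE HJ //; have [ub [j jJ jE]] := big_Rmax v J.
  by split=> [i iJ|]; [rewrite uv; apply: ub|exists j; rewrite ?uv].
pose t1 := (t0 + INR L / 2) / 2.
have t1L : t0 < t1 < INR L / 2 by rewrite /t1; lra.
have edom t : 0 <= t <= INR L -> edge_dom e t by rewrite /edge_dom le.
(* A monomial that attains [H] at [t1], strictly between the kink and the midpoint. *)
have [|_ [j jJ jE]] := Hmax e t1; first by apply: edom; lra.
pose phi e' t := IZR 1 * u j e' t + IZR (-1) * edge_fun H e' t.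
have phi0 e' t : edge_dom e' t -> phi e' t <= 0.
  by move=> /Hmax[/(_ j jJ) ub _]; rewrite /phi; lra.
(* The multiples of [D] cancel in the difference [u j - H], leaving the bound [B]. *)
have phi_ge : ord_ge phi B.
  have u_ge : ord_ge (u j) (scale_div (m * n) D).
    rewrite -(deg j jJ).
    apply/ord_ge_const/(@ord_ge_sum _ _ _ (mono j) _ (fun i => edge_fun (gen i))) => i iN.
    exact: inR_ord_ge pos (genR i iN).
  move=> x vx; have [z uz Dz] := u_ge x vx.
  exists (1 * z + -1 * (B x - scale_div (m * n) D x))%Z; last lia.
  by apply: edge_ord_lin => //; apply: ordH.
(* [phi] is this function minus [w], so near [t0] its only kink is that of [w]. *)
have [mu [nu affu]] : affine_on (fun t => 1 * u j e t + IZR M * edge_fun F e t) c (INR L / 2).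
  apply: affine_on_lin; last exact: (aff 0%N).
  have [i iN|mu [nu H']] :=
    @affine_on_sum N (fun i => INR (mono j i)) (fun i => edge_fun (gen i) e) c (INR L / 2).
    exact: (aff i.+1).
  by exists mu, (cst j + nu) => t tc; rewrite /u H' //; lra.
have phiE t : c < t < INR L / 2 -> phi e t = nu + mu * t - w e t.
  by move=> /affu <-; rewrite /phi HE opp_IZR; lra.
pose K := nu - IZR (g (src e)) + IZR a * t0 + IZR b * t0.
have phiR t : t0 <= t < INR L / 2 -> phi e t = K + (mu - IZR b) * t.
  by move=> tt; rewrite phiE ?/w ?kink_right /K; lra.
(* From [t0] to the midpoint [phi] is affine, and it attains its maximum 0 at the interior point
   [t1]. *)
have slope0 : mu - IZR b = 0.
  apply: (@affine_max_zero _ K t0 t1 (INR L / 2)) => //.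
    by rewrite -phiR /phi ?jE; lra.
  by move=> t tt; rewrite -phiR //; apply: phi0; apply: edom; lra.
have K0 : K = 0.
  by have := phiR t1; rewrite slope0 /phi jE; lra.
have near0 t : t0 <= t < INR L / 2 -> phi e t = 0 by move=> /phiR ->; rewrite slope0; lra.
have int0 t : t0 < t < INR L -> exists sr sl,
    right_slope (phi e) t sr /\ left_slope (phi e) t sl /\ (sl <= sr)%Z.
  move=> tt; have [|z [sr [sl [Hr [Hl ->]]]] Bz] := phi_ge (PE e t); first by rewrite /= le; lra.
  exists sr, sl; split=> //; split=> //.
  by move: Bz; rewrite BE /= eqxx; case: Req_EM_T => [?|? /=]; [lra|lia].
(* Beyond the midpoint generators may bend, but [phi] is convex right of [t0], so its zeros extend
   to [tgt e]. *)
have right0 t : t0 <= t <= INR L -> phi e t = 0.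
  move=> tt; case: (Rlt_le_dec t t1) => tt1; first by apply: near0; lra.
  apply: (@convex_zero _ t1 (INR L)); try lra.
  - by move=> t' ?; apply: phi0; apply: edom; lra.
  - by apply: near0; lra.
  - by exists (INR L / 2 - t1) => [|h ?]; rewrite ?near0; lra.
  - by move=> t' ?; apply: int0; lra.
  - have [z [o Ho _] _] := phi_ge (PV (tgt e)) I; exists (- o (inr e))%Z.
    by have := Ho (inr e) erefl; rewrite /= le.
have anchor_src (e' : E C) : anchor (src e') = src e'.
  by apply: anchor_not_tip => e2 inf /(@tip_half _ _ (inl e') (tip _ inf)).
(* Vertex values of [phi]; composing with [anchor] avoids points at infinity, where [real] of an
   infinite value is meaningless. *)
pose val v :=
  cst j + \big[Rplus/0]_(i < N) (INR (mono j i) * real (gen i (PV v))) - real (H (PV v)).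
have left0 : forall t, 0 <= t <= t0 -> phi e t = 0.
  apply: (@zero_propagates C e L t0 y phi (fun v => val (anchor v)) B) => //.
  - move=> e'; rewrite anchor_src /phi /u /val /edge_fun /Defs.fe.
    by case: Req_EM_T => [z0 /=|z0]; [lra|case: z0].
  - move=> e' l le'; rewrite anchor_not_tip; last first.
      by move=> e2 inf; apply: (@finite_end_not_tip _ (inr e')) => //=; rewrite le'.
    have := pos _ _ le' => l0; rewrite /phi /u /val /edge_fun /Defs.fe le'.
    by case: Req_EM_T => [?|? /=]; [lra|case: Req_EM_T => [z0 /=|z0]; [lra|case: z0]].
  - by move=> e' inf; rewrite anchor_tip ?anchor_src //; apply: tip.
  - move=> e' t ett; rewrite BE /=; case: (eqVneq e' e) => [eE|_ //].
    by case: Req_EM_T => [tE|//]; case: ett.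
  - move=> v; rewrite BV /dl /indic; case: (eqVneq v y) => [->|vy].
      by case: eqP.
    by case: (v == src e); case: (y == src e).
have ab : 0 < IZR a + IZR b.
  rewrite -plus_IZR; apply: (IZR_lt 0); rewrite /a /b -/M; nia.
(* Between [c] and [t0], [phi] equals [(a + b) * (t - t0)], which is negative at [t2], against
   [left0]. *)
pose t2 := (Rmax c 0 + t0) / 2.
have ? := Rmax_l c 0; have ? := Rmax_r c 0; have ? : Rmax c 0 < t0 by apply: Rmax_lub_lt; lra.
have : phi e t2 = 0 by apply: left0; rewrite /t2; lra.
rewrite phiE ?/w ?kink_left; try by rewrite /t2; lra.
have -> : mu = IZR b by lra.
have -> : nu = IZR (g (src e)) - IZR a * t0 - IZR b * t0 by move: K0; rewrite /K; lra.
have : t2 < t0 by rewrite /t2; lra.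
nra.
Qed.
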